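(* Let $L\subseteq\mathbb R^n$ be a convex body and $K\in\mathscr K(\mathbb R^n)$ with $K\subseteq L$. Assume that $K$ is $(c_K,\theta_K)$-thick. Let $\mu=(\mu_j)_{j\ge1}$ be an admissible weight satisfying $\mu_j\ge j$ for $j\ge1$. Let $M_0>b_0>0$. Assume that $(\mu,M_0,a_K,b_0)$ is admissible and let $\mathbf N=\mathbf N(\mu,M_0,a_K,b_0)$. Let $f:L\to\mathbb R$ be a $(\mu^{|\mathbf N},M_0)$-smooth function satisfying $\|f\|_K\ge b_0$. Then $\operatorname{ord}_xf\le\theta_K\mathbf N$ for all $x\in K$, where $$\operatorname{ord}_xf:=\limsup_{r\to0}\frac{\log\|f\|_{B(x,r)\cap K}}{\log r}.$$
   Context: $|E|$ denotes Lebesgue measure. A convex body is a compact convex set with nonempty interior. $B(x,r)$ is the ball of radius $r$ around $x$. A nonempty measurable set $K\subseteq\mathbb R^n$ is $(c_K,\theta_K)$-thick, where $c_K,\theta_K>0$, if $|K\cap B(x,r)|\ge c_K r^{\theta_K}$ for all $x\in K$ and $0<r\le1$. Weights and smoothness. An admissible weight is a sequence $\mu=(\mu_j)_{j\ge1}$ of reals with $0<\mu_1\le\mu_2\le\cdots$. Given $M_0>0$ put $M_j=M_0\mu_1\cdots\mu_j$, $j\ge1$. For $N\in\mathbb N_{\ge1}\cup\{\infty\}$ and nonempty compact $L\subseteq\mathbb R^n$, a function $f:L\to\mathbb R$ is $(\mu^{|N},M_0)$-smooth if it is of class $C^N$ in some open neighborhood of $L$ and $\sup_{x\in L}\sum_{|\alpha|=j}\frac{j!}{\alpha!}|\partial^\alpha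 f(x)|\le M_j$ for all integers $0\le j<N+1$. Also $\|f\|_E:=\sup_{x\in E}|f(x)|$. Degree. For $A,a,b>0$ let $j_0$ be the smallest nonnegative integer $\ge\log(A/b)$. The tuple $(\mu,A,a,b)$ is admissible if $\sum_{j=j_0+1}^\infty 1/\mu_j>a\,e$; then $\mathbf N(\mu,A,a,b):=2\sup\{k\in\mathbb N:\sum_{j=j_0+1}^k\frac1{a\mu_j}<e\}$ (empty sums are $0$). Admissible sets. A family $(K_w,a_w,\Upsilon_w)_{w\in W}$, where $W$ is any set, $K_w\subseteq[0,1]^n$ is compact, $a_w\in K_w$, and $\Upsilon_w:[0,\infty)^n\to\mathbb R^n$ is a map, is an admissible collection of degree $d\in\mathbb N_{\ge1}$ if there are constants $\delta_1,\delta_2,\delta_3>0$, $q\in\mathbb N_{\ge1}$ and polynomial maps $R_w:\mathbb R^n\to\mathbb R^n$ of degree at most $d$ such that for all $w\in W$: (1) $K_w$ is star-shaped with respect to $a_w$ and $|K_w|\ge\delta_1$; (2) $\Upsilon_w(x_1,\dots,x_n)=R_w(x_1^{1/q},\dots,x_n^{1/q})$; (3) $\delta_2\le\sum_\kappa|c_{w,\kappa}|\le\delta_3$, where $c_{w,\kappa}$ are the coefficients of the polynomial $\operatorname{Jac}(R_w)$ (the Jacobian determinant); (4) writing $a_w=(a_{w,1},\dots,a_{w,n})$, $a_{w,i}=0$ whenever $\Upsilon_w$ is not a polynomial map with respect to the variable $x_i$. A nonempty compact set $K\subseteq\mathbb R^n$ is admissible (of degree $d$) if there is an admissible collection (of degree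 $d$) $(K_w,a_w,\Upsilon_w)_{w\in K}$ indexed by $K$ with $\Upsilon_w(a_w)=w$ for each $w\in K$ and $K=\bigcup_{w\in K}\Upsilon_w(K_w)$. $\mathscr K(\mathbb R^n)$ is the family of all admissible sets. For each $K\in\mathscr K(\mathbb R^n)$ such a collection and its degree $d$ are fixed ($d=1$ if $K$ is a convex body), and $$a_K:=4\,\tfrac{(d+1)^{d+1}}{(d-1)^{d-1}}\max\{\operatorname{diam}(K),1\}\ \text{ if }d\ge2,\qquad a_K:=\operatorname{diam}(K)\ \text{ if }d=1.$$ *)

(* Defs.v *)
From HB Require Import structures.
From mathcomp Require Import all_boot all_order all_algebra.
From mathcomp Require Import all_classical all_reals all_analysis.
(* The notations of mpoly clash with those of all_analysis. *)
From mathcomp Require mpoly.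
Import (canonicals, coercions) mpoly.

Set Implicit Arguments.
Unset Strict Implicit.
Unset Printing Implicit Defensive.

Import Order.TTheory GRing.Theory Num.Theory.
Import numFieldNormedType.Exports.

Local Open Scope classical_set_scope.
Local Open Scope ring_scope.

Section Euclidean.
Context {R : realType} {n : nat}.
Implicit Types (x y a b : 'rV[R]_n) (A : set 'rV[R]_n).

(* The library's norm on matrices is the sup norm; it induces the same topology,
   but balls and diameters must be Euclidean. *)
Definition enorm x : R := Num.sqrt (\sum_(i < n) x 0 i ^+ 2).

Definition eball x (r : R) : set 'rV[R]_n := [set y | enorm (y - x) < r].

Definition diam A : R := sup [set enorm (x - y) | x in A & y in A].

Definition box a b : set 'rV[R]_n := [set x | forall i, a 0 i <= x 0 i <= b 0 i].

(* n-dimensional Lebesgue outer measure, for n >= 1; its restriction to the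
   Caratheodory measurable sets is Lebesgue measure. *)
Definition leb A : \bar R :=
  ereal_inf [set s | exists a b : nat -> 'rV[R]_n,
    [/\ forall k i, a k 0 i <= b k 0 i,
        A `<=` \bigcup_k box (a k) (b k) &
        s = (\sum_(0 <= k <oo) (\prod_(i < n) (b k 0 i - a k 0 i))%:E)%E]].

Definition convex_body A : Prop :=
  [/\ compact A, convex_set A & interior A !=set0].

Definition thick (c theta : R) A : Prop :=
  [/\ 0 < c, 0 < theta, A !=set0, leb.-caratheodory A &
      forall x (r : R), A x -> 0 < r <= 1 ->
        ((c * r `^ theta)%:E <= leb (A `&` eball x r))%E].

Definition star_shaped a A : Prop :=
  forall x (t : R), A x -> 0 <= t <= 1 -> A (a + t *: (x - a)).

Definition orthant : set 'rV[R]_n := [set x | forall i, 0 <= x 0 i].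

Definition supnorm (f : 'rV[R]_n -> R) A : \bar R :=
  ereal_sup [set `|f x|%:E | x in A].

End Euclidean.

Section Smooth.
Context {R : realType} {n : nat}.

(* [pderiv [:: i1; ...; ik] g] is d_i1 (... (d_ik g)). *)
Definition pderiv (s : seq 'I_n) (g : 'rV[R]_n -> R) : 'rV[R]_n -> R :=
  foldr (fun i (h : 'rV[R]_n -> R) x => 'D_(delta_mx 0 i) h x) g s.

Definition mderivative (alpha : 'I_n -> nat) : ('rV[R]_n -> R) -> 'rV[R]_n -> R :=
  pderiv (flatten [seq nseq (alpha i) i | i <- enum 'I_n]).

(* Orders of smoothness are extended reals, so that [N] may be a natural number
   or +oo. *)
Definition class_C (N : \bar R) (g : 'rV[R]_n -> R) (U : set 'rV[R]_n) : Prop :=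
  (forall s : seq 'I_n, ((size s)%:R%:E <= N)%E ->
     forall x, U x -> {for x, continuous (pderiv s g)}) /\
  (forall (s : seq 'I_n) (i : 'I_n), ((size s).+1%:R%:E <= N)%E ->
     forall x, U x -> derivable (pderiv s g) x (delta_mx 0 i)).

(* sum over |alpha| = j of (j! / alpha!) |d^alpha g (x)| *)
Definition deriv_size (g : 'rV[R]_n -> R) (j : nat) (x : 'rV[R]_n) : R :=
  \sum_(alpha : {ffun 'I_n -> 'I_j.+1} | (\sum_i alpha i == j)%N)
     j`!%:R / (\prod_i (alpha i)`!)%N%:R * `|mderivative (fun i => alpha i) g x|.

(* Weights are indexed from 1; the value at 0 is never used. *)
Definition admissible_weight (mu : nat -> R) : Prop :=
  0 < mu 1%N /\ forall j, (1 <= j)%N -> mu j <= mu j.+1.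

Definition Mseq (mu : nat -> R) (M0 : R) (j : nat) : R :=
  M0 * \prod_(1 <= i < j.+1) mu i.

(* A function on L is given by a total function f whose values outside L are
   irrelevant; g is its extension to the neighbourhood U. *)
Definition smooth (mu : nat -> R) (N : \bar R) (M0 : R) (L : set 'rV[R]_n)
    (f : 'rV[R]_n -> R) : Prop :=
  exists (U : set 'rV[R]_n) (g : 'rV[R]_n -> R),
    [/\ open U, L `<=` U, (forall x, L x -> g x = f x), class_C N g U &
      forall j : nat, (j%:R%:E < N + 1)%E ->
        (ereal_sup [set (deriv_size g j x)%:E | x in L] <= (Mseq mu M0 j)%:E)%E].

(* The quotient is taken in the extended reals: log 0 = -oo, so it equals +oo
   when f vanishes on B(x, r) and K. *)
Definition ord_at (K : set 'rV[R]_n) (f : 'rV[R]_n -> R) (x : 'rV[R]_n) : \bar R :=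
  limf_esup (fun r : R => (lne (supnorm f (eball x r `&` K)) * (ln r)^-1%:E)%E)
    (0 : R)^'+.

End Smooth.

Section Degree.
Context {R : realType}.
Implicit Types (mu : nat -> R) (A a b : R).

Lemma exists_nat_ge (x : R) : exists j : nat, x <= j%:R.
Proof.
exists (Num.bound `|x|); apply: le_trans (ler_norm _) (ltW _).
exact: archi_boundP.
Qed.

Definition start_index A b : nat := ex_minn (exists_nat_ge (ln (A / b))).

Definition admissible_tuple mu A a b : Prop :=
  [/\ 0 < A, 0 < a, 0 < b &
    ((a * expR 1)%:E < \sum_((start_index A b).+1 <= j <oo) ((mu j)^-1)%:E)%E].

Definition degN mu A a b : \bar R :=
  (2%:E * ereal_sup [set (k%:R)%:E | k in [set k : nat |
     (\sum_((start_index A b).+1 <= j < k.+1) (a * mu j)^-1 < expR 1)%R]])%E.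

End Degree.

Section AdmissibleSets.
Context {R : realType} {n : nat}.

Definition poly_map (P : 'I_n -> mpoly.mpoly n R) (x : 'rV[R]_n) : 'rV[R]_n :=
  \row_i mpoly.meval (fun j => x 0 j) (P i).

Definition jac (P : 'I_n -> mpoly.mpoly n R) : mpoly.mpoly n R :=
  \det (\matrix_(i, j) (mpoly.mderiv j (P i) : mpoly.mpoly n R)).

Definition coef_size (p : mpoly.mpoly n R) : R :=
  \sum_(m <- mpoly.msupp p) `|mpoly.mcoeff m p|.

Definition root_coords (q : nat) (x : 'rV[R]_n) : 'rV[R]_n :=
  \row_i (x 0 i) `^ (q%:R^-1).

Definition set_coord (x : 'rV[R]_n) (i : 'I_n) (t : R) : 'rV[R]_n :=
  \row_j (if j == i then t else x 0 j).

(* Y : [0, oo[^n -> R^n is polynomial in the i-th variable, the others being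
   fixed. *)
Definition polynomial_in (Y : 'rV[R]_n -> 'rV[R]_n) (i : 'I_n) : Prop :=
  forall x, orthant x -> forall k : 'I_n,
    exists p : {poly R}, forall t : R, 0 <= t -> Y (set_coord x i t) 0 k = p.[t].

(* Maps on [0, oo[^n are total functions constrained only on the orthant. The
   degree of a polynomial p is at most d when msize p <= d + 1. *)
Definition admissible_collection (I : Type) (W : set I) (d : nat)
    (Kw : I -> set 'rV[R]_n) (aw : I -> 'rV[R]_n)
    (Y : I -> 'rV[R]_n -> 'rV[R]_n) : Prop :=
  [/\ (1 <= d)%N,
      forall w, W w ->
        [/\ Kw w `<=` box (const_mx 0) (const_mx 1), compact (Kw w) & Kw w (aw w)] &
      exists (delta1 delta2 delta3 : R) (q : nat) (P : I -> 'I_n -> mpoly.mpoly n R),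
        [/\ 0 < delta1, 0 < delta2, 0 < delta3, (1 <= q)%N &
          forall w, W w ->
            [/\ forall i, (mpoly.mmeasure mpoly.mdeg (P w i) <= d.+1)%N,
                star_shaped (aw w) (Kw w) /\ (delta1%:E <= leb (Kw w))%E,
                forall x, orthant x -> Y w x = poly_map (P w) (root_coords q x),
                delta2 <= coef_size (jac (P w)) <= delta3 &
                forall i, ~ polynomial_in (Y w) i -> aw w 0 i = 0]]].

Definition admissible_set (d : nat) (K : set 'rV[R]_n) : Prop :=
  [/\ K !=set0, compact K &
      exists (Kw : 'rV[R]_n -> set 'rV[R]_n) (aw : 'rV[R]_n -> 'rV[R]_n)
             (Y : 'rV[R]_n -> 'rV[R]_n -> 'rV[R]_n),
        [/\ admissible_collection K d Kw aw Y,
            forall w, K w -> Y w (aw w) = w &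
            K = \bigcup_(w in K) (Y w @` Kw w)]].

Definition aconst (d : nat) (K : set 'rV[R]_n) : R :=
  if (2 <= d)%N then
    4 * (d.+1%:R ^+ d.+1 / d.-1%:R ^+ d.-1) * Num.max (diam K) 1
  else diam K.

End AdmissibleSets.

(* Main.v *)
(** With [N = 2 k], choose [w] in [K] with [|f w| >= b_0] and put [v = w - x].
   If [ord_x f > theta N], then [|f| <= r^(theta N)] on [K /\ B(x, r)] for
   arbitrarily small [r].  As this set has measure at least [c r^theta], by
   pigeonhole some line of direction [v] passes very near many of its points, with
   gaps of order [r^theta].  The mean value theorem, iterated [j <= k] times, gives
   a point near [x] where the [j]-th derivative of [f] along [v] is
   [O(r^(theta N - theta j))].  So the derivatives of order at most [k] along [v]
   vanish at [x], and Bang's argument on the segment from [x] to [w], which lies in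
   [L] and has length at most [diam K <= a_K = a], gives
   [\sum_(j_0 < j <= k + 1) 1 / (a mu_j) < e], against the choice of [k]. *)

Require Import Defs.
From mathcomp Require Import all_boot all_order all_algebra.
From mathcomp Require Import all_classical all_reals all_analysis.
From mathcomp Require Import ring lra.

Import Order.TTheory GRing.Theory Num.Theory.
Import numFieldNormedType.Exports.

Local Open Scope classical_set_scope.
Local Open Scope ring_scope.

(** Near [x] the segment from [x] to [w] may contain no further point of K, so smallness on K does
    not by itself bound derivatives along [v]. Thickness only gives points of K close to some
    parallel line. Moving them onto that line is affordable since [f] is Lipschitz near [x], and the
    tube can be taken as thin as desired: the constant relating measure to gaps does not depend on
    its width.

    The factor 2 in N = 2 k has two effects: theta N - theta j stays positive for j <= k, and [f]
    has the k + 1 <= 2 k derivatives that Bang's argument uses, where k >= j_0 >= 1 because M_0 >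
    b_0.

    The weights j!/alpha! turn the sum over multi-indices into the sum of |d_(i1) ... d_(ij) f| over
    all words i1 ... ij. Hence the j-th derivative along [v] is at most a^j M_j on L, with no
    constant depending on the dimension, and the ratio of consecutive bounds is a mu_j. The sum
    starts after j_0 because e^(-j_0) M_0 <= b_0 <= |f w|: a bound by less than e^(-j_0) M_0 at [w]
    is already contradictory. *)

(** * Mean value estimates and Bang's argument in one variable *)

Section OneVariable.
Context {R : realType}.
Implicit Types (a b t : R).

(** Both [psi + phi] and [psi - phi] are nondecreasing. The majorant is a function rather than a
    slope because Bang's argument compares with exponentials. *)
Lemma increment_le (phi dphi psi dpsi : R -> R) a b : a <= b ->
  (forall t, a <= t <= b -> is_derive t (1 : R) phi (dphi t)) ->
  (forall t, a <= t <= b -> is_derive t (1 : R) psi (dpsi t)) ->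
  (forall t, a <= t <= b -> `|dphi t| <= dpsi t) ->
  `|phi b - phi a| <= psi b - psi a.
Proof.
move=> ab dphiP dpsiP le_d.
have key (chi dchi : R -> R) : (forall t, a <= t <= b -> is_derive t (1 : R) chi (dchi t)) ->
    (forall t, a <= t <= b -> 0 <= dchi t) -> chi a <= chi b.
  move=> dchiP ge0.
  have dchi_in t : t \in `]a, b[ -> is_derive t (1 : R) chi (dchi t).
    by rewrite in_itv/= => /andP[at_ tb]; apply: dchiP; rewrite !ltW.
  have chi_cont : {within `[a, b], continuous chi}.
    apply: derivable_within_continuous => t; rewrite in_itv/= => tab.
    by have [] := dchiP t tab.
  have [t] := MVT_segment ab dchi_in chi_cont.
  by rewrite in_itv/= => tab eqD; rewrite -subr_ge0 eqD mulr_ge0 ?subr_ge0// ge0.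
rewrite ler_norml; apply/andP; split.
- have := key (psi + phi) (fun t => dpsi t + dphi t).
  have H1 : forall t, a <= t <= b -> is_derive t (1 : R) (psi + phi) (dpsi t + dphi t).
    by move=> t tab; have := dphiP t tab; have := dpsiP t tab => ? ?; apply: is_deriveD.
  have H2 : forall t, a <= t <= b -> 0 <= dpsi t + dphi t.
    move=> t tab; have := le_d t tab; rewrite ler_norml; lra.
  move/(_ H1 H2); rewrite !fctE; lra.
- have := key (psi - phi) (fun t => dpsi t - dphi t).
  have H1 : forall t, a <= t <= b -> is_derive t (1 : R) (psi - phi) (dpsi t - dphi t).
    by move=> t tab; have := dphiP t tab; have := dpsiP t tab => ? ?; apply: is_deriveB.
  have H2 : forall t, a <= t <= b -> 0 <= dpsi t - dphi t.
    move=> t tab; have := le_d t tab; rewrite ler_norml; lra.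
  move/(_ H1 H2); rewrite !fctE; lra.
Qed.

Lemma is_derive_expR_scale (c k t0 t : R) :
  is_derive t (1 : R) (fun t => c * expR (k * (t - t0))) (c * k * expR (k * (t - t0))).
Proof.
have d1 : is_derive t (1 : R) (fun t => k * (t - t0)) k.
  have -> : (fun t => k * (t - t0)) = k *: (id - cst t0) by apply/funext => u; rewrite !fctE.
  by apply: is_derive_eq; rewrite subr0 /GRing.scale /= mulr1.
have d2 := @is_derive1_comp R expR (fun t => k * (t - t0)) t _ _ (is_derive_expR _) d1.
have -> : (fun t => c * expR (k * (t - t0))) = c *: (expR \o (fun t => k * (t - t0))).
  by apply/funext.
by apply: is_derive_eq; rewrite /GRing.scale /= -mulrA; congr (_ * _); exact: mulrC.
Qed.

(* With [nu_k = A_k / A_(k-1)], the time up to which [|g_j| <= e^(j-k) A_j] for all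
   [j <= k] grows by at least [1 / (e nu_k)] when [k] is replaced by [k - 1]. *)
Lemma bang_sum_inv_lt (g : nat -> R -> R) (A nu : nat -> R) (m j0 : nat) :
  (0 < j0 <= m)%N ->
  (forall j t, (j < m)%N -> 0 <= t <= 1 -> is_derive t (1 : R) (g j) (g j.+1 t)) ->
  (forall j, (j < m)%N -> g j 0 = 0) ->
  (forall j t, (j <= m)%N -> 0 <= t <= 1 -> `|g j t| <= A j) ->
  0 < A 0%N -> (forall j, A j.+1 = A j * nu j.+1) ->
  (forall j, 0 < nu j.+1) -> (forall j, nu j.+1 <= nu j.+2) ->
  expR (- j0%:R) * A 0%N <= `|g 0%N 1| ->
  \sum_(j0.+1 <= j < m.+1) (nu j)^-1 < expR 1.
Proof.
move=> /andP[j0_gt0 j0m] dg g0 gA A0 AS nu_gt0 nuS g1.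
have A_gt0 j : 0 < A j by elim: j => // j IH; rewrite AS mulr_gt0.
have nu_le i j : (0 < i <= j)%N -> nu i <= nu j.
  case: i => // i /andP[_]; elim: j => // j IH; rewrite leq_eqVlt => /predU1P[-> //|ij].
  case: j IH ij => // j IH ij; apply: le_trans (nuS j); exact: IH.
rewrite ltNge; apply/negP => sum_ge.
pose tau k := (expR 1)^-1 * \sum_(k.+1 <= j < m.+1) (nu j)^-1.
have tau_ge0 k : 0 <= tau k.
  rewrite mulr_ge0 ?invr_ge0 ?expR_ge0//.
  rewrite big_nat_cond sumr_ge0// => -[|i] //= _; by rewrite invr_ge0 ltW.
have tauS k : (k < m)%N -> tau k = tau k.+1 + (expR 1 * nu k.+1)^-1.
  by move=> km; rewrite /tau big_ltn// mulrDr addrC invfM.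
(* Descending induction on the level [k = m - i]. It starts at [tau m = 0], where all orders below
   [m] vanish. Strictness below the level is carried along because the lower bound at time [1] is
   not strict. *)
have key i t : (i <= m)%N -> 0 <= t <= 1 -> t <= tau (m - i)%N -> forall j, (j <= m - i)%N ->
    `|g j t| <= expR (j%:R - (m - i)%:R) * A j /\
    ((j < m - i)%N -> `|g j t| < expR (j%:R - (m - i)%:R) * A j).
  elim: i t => [|i IH] t im t01 ttau j.
    rewrite subn0 in ttau *.
    have t0 : t = 0.
      by apply: le_anti; move: ttau; rewrite /tau big_geq// mulr0 => ->; case/andP: t01.
    rewrite leq_eqVlt => /predU1P[->|jm].
      by rewrite ltnn subrr expR0 mul1r; split => //; exact: gA.
    rewrite t0 g0// normr0; split=> [|_]; rewrite ?mulr_ge0 ?mulr_gt0 ?expR_ge0 ?expR_gt0//.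
    by rewrite ltW.
  have [k kE] : exists k, (m - i = k.+1)%N by exists (m - i).-1; rewrite prednK// subn_gt0.
  have kE' : (m - i.+1 = k)%N by rewrite subnS kE.
  have km : (k < m)%N by rewrite -kE leq_subr.
  rewrite kE' in ttau *; rewrite kE in IH.
  move=> jk; suff : `|g j t| < expR (j%:R - k%:R) * A j by move=> H; split => // ; exact: ltW.
  have [t_le|t_gt] := leP t (tau k.+1).
    have [_ /(_ jk)] := IH t (ltnW im) t01 t_le j (leqW jk).
    move/lt_le_trans; apply; rewrite ler_pM2r// ler_expR; rewrite -[k.+1]addn1 natrD; lra.
  pose T := tau k.+1; pose K := expR 1 * nu k.+1.
  have T01 : 0 <= T <= 1 by rewrite tau_ge0 /T ltW// (lt_le_trans t_gt)//; case/andP: t01.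
  have K_gt0 : 0 < K by rewrite mulr_gt0 ?expR_gt0.
  (* At time [T] the function [psi j] equals the bound of level [k + 1]; after a duration of at most
     [1 / K] it has grown by a factor of at most e, up to the bound of level [k]. The rate [K] makes
     [psi j.+1] at most the derivative of [psi j] for [j <= k], since [nu] is nondecreasing. *)
  pose psi j u := (expR (j%:R - k.+1%:R) * A j) * expR (K * (u - T)).
  (* The orders are treated downwards from [k + 1], where the a priori bound [A k.+1] is available:
     a bound for [g l.+1] on [[T, u]] integrates to one for [g l]. *)
  have step d : (d <= k.+1)%N -> forall u, T <= u <= t ->
      `|g (k.+1 - d)%N u| <= psi (k.+1 - d)%N u /\
      ((0 < d)%N -> `|g (k.+1 - d)%N u| < psi (k.+1 - d)%N u).
    elim: d => [|d IHd] dk u /andP[Tu ut].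
      have u01 : 0 <= u <= 1.
        by case/andP: T01 => T0 _; case/andP: t01 => _ t1; rewrite (le_trans T0)//= (le_trans ut).
      rewrite subn0; split=> //; apply: le_trans (gA _ _ km u01) _.
      rewrite /psi subrr expR0 mul1r ler_peMr ?(ltW (A_gt0 _))//.
      by rewrite -[leLHS]expR0 ler_expR mulr_ge0 ?subr_ge0// ltW.
    have [l lE] : exists l, (k.+1 - d = l.+1)%N by exists (k.+1 - d).-1; rewrite prednK// subn_gt0.
    rewrite subnS lE /=; rewrite lE in IHd.
    have lk : (l <= k)%N by rewrite -ltnS -lE leq_subr.
    have sub s : T <= s <= u -> 0 <= s <= 1.
      case/andP=> Ts su; case/andP: T01 => T0 _; case/andP: t01 => _ t1.
      by rewrite (le_trans T0)//= (le_trans su)// (le_trans ut).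
    suff H : `|g l u| < psi l u by split=> [|//]; exact: ltW.
    have inc : `|g l u - g l T| <= psi l u - psi l T.
      apply: (@increment_le (g l) (g l.+1) (psi l)
        (fun s => expR (l%:R - k.+1%:R) * A l * K * expR (K * (s - T)))) => //.
      - move=> s sTu; apply: dg; [exact: leq_ltn_trans km|exact: sub].
      - by move=> s _; exact: is_derive_expR_scale.
      - move=> s /andP[Ts su].
        have [|+ _] := IHd (ltnW dk) s; first by rewrite Ts (le_trans su).
        move/le_trans; apply; rewrite /psi ler_pM2r ?expR_gt0// AS.
        have -> : expR (l.+1%:R - k.+1%:R) = expR (l%:R - k.+1%:R) * expR 1 :> R.
          by rewrite -expRD; congr expR; rewrite -[l.+1]addn1 natrD; ring.
        rewrite /K [leLHS](_ : _ = expR (l%:R - k.+1%:R) * A l * (expR 1 * nu l.+1)); last by ring.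
        rewrite ler_pM2l ?mulr_gt0 ?expR_gt0// ler_pM2l ?expR_gt0//.
        exact: nu_le.
    have [_ /(_ lk)] := IH T (ltnW im) T01 (lexx _) l (leqW lk).
    have -> : expR (l%:R - k.+1%:R) * A l = psi l T.
      by rewrite /psi subrr mulr0 expR0 mulr1.
    have := ler_normD (g l u - g l T) (g l T); rewrite subrK.
    move: inc; lra.
  have Ttt : T <= t <= t by rewrite lexx ltW.
  have [_] := step (k.+1 - j)%N (leq_subr _ _) t Ttt.
  rewrite subn_gt0 ltnS (subKn (leqW jk)) => /(_ jk)/lt_le_trans; apply.
  rewrite /psi mulrAC ler_pM2r// -expRD ler_expR.
  have : K * (t - T) <= 1.
    rewrite -[leRHS](mulfV (lt0r_neq0 K_gt0)) ler_pM2l// lerBlDl.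
    by rewrite -tauS.
  rewrite -[k.+1]addn1 natrD; lra.
have := key (m - j0)%N 1 (leq_subr _ _); rewrite subKn// lexx ler01 => /(_ isT).
have -> : 1 <= tau j0.
  by rewrite /tau mulrC ler_pdivlMr ?expR_gt0// mul1r.
move=> /(_ isT 0%N isT)[_ /(_ j0_gt0)]; rewrite sub0r; lra.
Qed.

(* Applying the mean value theorem on every other gap keeps the gaps of the new
   points at least [delta]. *)
Lemma small_derivative_of_gaps (g : nat -> R -> R) (a b delta : R) (j : nat) :
  0 < delta ->
  (forall i t, (i < j)%N -> a <= t <= b -> is_derive t (1 : R) (g i) (g i.+1 t)) ->
  forall (eps : R) (p : nat -> R),
  (forall i, (i < 2 ^ j)%N -> a <= p i <= b /\ `|g 0%N (p i)| <= eps) ->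
  (forall i, (i.+1 < 2 ^ j)%N -> p i + delta <= p i.+1) ->
  exists2 xi, a <= xi <= b & `|g j xi| <= (2 / delta) ^+ j * eps.
Proof.
move=> delta0; elim: j g => [|j IH] g dg eps p pP pgap.
  have [pab gp] := pP 0%N isT.
  by exists (p 0%N); rewrite // expr0 mul1r.
have lt2 i : (i < 2 ^ j)%N -> (i.*2.+1 < 2 ^ j.+1)%N.
  by rewrite expnS mul2n ltn_Sdouble.
have {}/choice[q qP] : forall i, exists xi, (i < 2 ^ j)%N ->
    [/\ p i.*2 <= xi, xi <= p i.*2.+1 & `|g 1%N xi| <= 2 / delta * eps].
  move=> i; have [ij|_] := boolP (i < 2 ^ j)%N; last by exists 0.
  have [/andP[ap _] g1] := pP i.*2 (ltnW (lt2 _ ij)).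
  have [/andP[_ pb] g2] := pP _ (lt2 _ ij).
  have gap := pgap i.*2 (lt2 _ ij).
  have plt : p i.*2 < p i.*2.+1 by rewrite (lt_le_trans _ gap)// ltrDl.
  have sub t : p i.*2 <= t <= p i.*2.+1 -> a <= t <= b.
    by case/andP => pt tp; rewrite (le_trans ap)//= (le_trans tp).
  have d_in t : t \in `]p i.*2, p i.*2.+1[ -> is_derive t (1 : R) (g 0%N) (g 1%N t).
    by rewrite in_itv/= => /andP[pt tp]; apply: dg => //; apply: sub; rewrite !ltW.
  have cont : {within `[p i.*2, p i.*2.+1], continuous (g 0%N)}.
    apply: derivable_within_continuous => t; rewrite in_itv/= => tp.
    by have [] := dg 0%N t isT (sub _ tp).
  have [xi] := MVT_segment (ltW plt) d_in cont.
  rewrite in_itv/= => /andP[pxi xip] E; exists xi => _; split=> //.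
  have : `|g 1%N xi| * delta <= 2 * eps.
    apply: le_trans (_ : `|g 1%N xi * (p i.*2.+1 - p i.*2)| <= _).
      rewrite normrM ler_wpM2l// ger0_norm; lra.
    rewrite -E; apply: le_trans (ler_normB _ _) _; lra.
  by rewrite -ler_pdivlMr// mulrAC.
have [|||xi xiab H] := IH (fun i => g i.+1) _ (2 / delta * eps) q.
- by move=> i t ij; exact: dg.
- move=> i ij; have [q1 q2 q3] := qP i ij; split=> //.
  have [/andP[ap _] _] := pP i.*2 (ltnW (lt2 _ ij)).
  have [/andP[_ pb] _] := pP _ (lt2 _ ij).
  by rewrite (le_trans ap)//= (le_trans q2).
- move=> i ij; have [_ q2 _] := qP i (ltnW ij); have [q1 _ _] := qP _ ij.
  apply: le_trans q1; apply: le_trans (_ : p i.*2.+1 + delta <= _); first by rewrite lerD2r.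
  by rewrite doubleS; apply: pgap; have := lt2 _ ij; rewrite doubleS => /ltnW.
- by exists xi => //; rewrite exprSr -mulrA.
Qed.

End OneVariable.

(** * Differentiability from continuous partial derivatives, and symmetry of mixed ones *)

Section SeveralVariables.
Context {R : realType} {n : nat}.
Implicit Types (x y z v : 'rV[R]_n) (phi : 'rV[R]_n -> R).

Local Notation e_ i := (delta_mx 0 i : 'rV[R]_n).

Lemma coord_le_norm x i : `|x 0 i| <= `|x|.
Proof.
by rewrite [leRHS]/Num.norm /= mx_normrE; apply/bigmax_geP; right => /=; exists (0, i).
Qed.

Lemma norm_le_coord x (r : R) : 0 <= r -> (forall i, `|x 0 i| <= r) -> `|x| <= r.
Proof.
move=> r0 xr; rewrite [leLHS]/Num.norm /= mx_normrE; apply/bigmax_leP; split=> //=.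
by move=> [a i] _; rewrite (ord1 a).
Qed.

Lemma norm_delta_le i : `|e_ i| <= 1 :> R.
Proof.
apply: norm_le_coord => // j; rewrite mxE eqxx /=.
by case: (_ == _); rewrite ?normr1 ?normr0.
Qed.

Lemma nbhs_closed_ball x (A : set 'rV[R]_n) : nbhs x A ->
  exists2 rho : R, 0 < rho & forall y, `|y - x| <= rho -> A y.
Proof.
move=> /nbhs_normP[e /= e0 eA]; exists (e / 2); first by rewrite divr_gt0.
move=> y yx; apply: eA; rewrite /ball_/= distrC; apply: le_lt_trans yx _.
by rewrite ltr_pdivrMr// ltr_pMr// ltr1n.
Qed.

Lemma is_derive_line phi y v (t d : R) :
  is_derive (y + t *: v) v phi d ->
  is_derive t (1 : R) (fun s => phi (y + s *: v)) d.
Proof.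
have E : (fun h : R => h^-1 *: ((phi \o shift (y + t *: v)) (h *: v) - phi (y + t *: v))) =
  (fun h : R => h^-1 *: (((fun s => phi (y + s *: v)) \o shift t) (h *: 1) -
     (fun s => phi (y + s *: v)) t)).
  apply/funext => h /=; congr (_ *: (phi _ - _)).
  by rewrite [h *: 1]mulr1 scalerDl addrCA.
by case; rewrite /derivable /derive E => ? <-; split.
Qed.

(** Points between [0] and [t] are written [u * t], so that [t] may have either sign. *)
Lemma increment_sub_linear_le (h dh : R -> R) (t c eps : R) :
  (forall u, 0 <= u <= 1 -> is_derive (u * t) (1 : R) h (dh (u * t))) ->
  (forall u, 0 <= u <= 1 -> `|dh (u * t) - c| <= eps) ->
  `|h t - h 0 - c * t| <= eps * `|t|.
Proof.
move=> dhP dhc.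
have dlin (k s : R) : is_derive s (1 : R) ( *%R k) k.
  by have -> : *%R k = k *: (@id R) by []; apply: is_derive_eq; rewrite /GRing.scale /= mulr1.
have dsub u : 0 <= u <= 1 -> is_derive (u * t) (1 : R) (h - *%R c) (dh (u * t) - c).
  by move=> ut; have := dhP u ut => ?; have := dlin c (u * t) => ?; apply: is_deriveB.
have [t0|t0|->] := ltgtP t 0; last by rewrite subrr mulr0 normr0 mulr0 subrr normr0.
- have uE s : t <= s <= 0 -> exists2 u, 0 <= u <= 1 & s = u * t.
    move=> /andP[ts s0]; exists (s / t); last by rewrite divfK// lt_eqF.
    by rewrite ler_ndivlMr// ler_ndivrMr// mul0r mul1r s0 ts.
  have : `|(h - *%R c) 0 - (h - *%R c) t| <= eps * 0 - eps * t.
    apply: (@increment_le R _ (fun s => dh s - c) _ (fun=> eps)) (ltW t0) _ _ _.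
    + by move=> s /uE[u u01 ->]; exact: dsub.
    + by move=> s /uE[u u01 ->]; exact: dhc.
  by rewrite !fctE mulr0 subr0 -[leLHS]normrN opprB addrAC mulr0 sub0r (ltr0_norm t0) mulrN.
- have uE s : 0 <= s <= t -> exists2 u, 0 <= u <= 1 & s = u * t.
    move=> /andP[s0 st]; exists (s / t); last by rewrite divfK// gt_eqF.
    by rewrite ler_pdivlMr// ler_pdivrMr// mul0r mul1r s0 st.
  have : `|(h - *%R c) t - (h - *%R c) 0| <= eps * t - eps * 0.
    apply: (@increment_le R _ (fun s => dh s - c) _ (fun=> eps)) (ltW t0) _ _ _.
    + by move=> s /uE[u u01 ->]; exact: dsub.
    + by move=> s /uE[u u01 ->]; exact: dhc.
  by rewrite !fctE mulr0 subr0 addrAC mulr0 subr0 (gtr0_norm t0).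
Qed.

(* Moving from [z] to [y] one coordinate at a time stays in the sup-norm ball. *)
Lemma increment_gradient_le phi x (c : 'I_n -> R) (rho eps : R) :
  (forall y i, `|y - x| <= rho -> derivable phi y (e_ i)) ->
  (forall y i, `|y - x| <= rho -> `|'D_(e_ i) phi y - c i| <= eps) ->
  forall y z, `|y - x| <= rho -> `|z - x| <= rho ->
  `|phi y - phi z - \sum_i c i * (y 0 i - z 0 i)| <= eps * \sum_i `|y 0 i - z 0 i|.
Proof.
move=> dphi dphic y z yx zx.
have rho0 : 0 <= rho by exact: le_trans yx.
pose w k : 'rV[R]_n := \row_i (if (i < k)%N then y 0 i else z 0 i).
have w0 : w 0%N = z by apply/rowP => i; rewrite mxE.
have wn : w n = y by apply/rowP => i; rewrite mxE ltn_ord.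
suff key k : (k <= n)%N ->
    `|phi (w k) - phi z - \sum_(i < n | (i < k)%N) c i * (y 0 i - z 0 i)| <=
    eps * \sum_(i < n | (i < k)%N) `|y 0 i - z 0 i|.
  have := key n (leqnn n); rewrite wn.
  by rewrite (eq_bigl xpredT) 1?[in X in _ <= X](eq_bigl xpredT)// => i; rewrite ltn_ord.
elim: k => [_|k IH kn].
  by rewrite w0 !big_pred0// subrr subr0 normr0 mulr0.
pose i0 := Ordinal kn.
pose t := y 0 i0 - z 0 i0.
have wS : w k.+1 = w k + t *: e_ i0.
  apply/rowP => i; rewrite !mxE eqxx /=.
  have [->|ii0] := eqVneq i i0; first by rewrite ltnS leqnn ltnn mulr1 /t addrC subrK.
  rewrite mulr0 addr0 ltnS leq_eqVlt.
  by have -> : (i == k :> nat) = false by apply: contraNF ii0 => /eqP ik; apply/eqP/val_inj.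
have inc : `|phi (w k.+1) - phi (w k) - c i0 * t| <= eps * `|t|.
  have in_ball u : 0 <= u <= 1 -> `|w k + (u * t) *: e_ i0 - x| <= rho.
    move=> /andP[u0 u1]; apply: norm_le_coord => // i; rewrite !mxE eqxx /=.
    have yi := le_trans (coord_le_norm (y - x) i) yx.
    have zi := le_trans (coord_le_norm (z - x) i) zx; rewrite !mxE in yi zi.
    have [ii0|ii0] := eqVneq i i0; last by rewrite mulr0 addr0; case: ifP.
    rewrite ii0 ltnn mulr1 /t -ii0.
    have -> : z 0 i + u * (y 0 i - z 0 i) - x 0 i =
      (1 - u) * (z 0 i - x 0 i) + u * (y 0 i - x 0 i) by ring.
    apply: le_trans (ler_normD _ _) _; rewrite !normrM (ger0_norm u0) ger0_norm ?subr_ge0//.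
    have : (1 - u) * `|z 0 i - x 0 i| <= (1 - u) * rho by rewrite ler_wpM2l ?subr_ge0.
    have : u * `|y 0 i - x 0 i| <= u * rho by rewrite ler_wpM2l.
    lra.
  have := @increment_sub_linear_le (fun s => phi (w k + s *: e_ i0))
    (fun s => 'D_(e_ i0) phi (w k + s *: e_ i0)) t (c i0) eps.
  rewrite scale0r addr0 -wS; apply=> u u01; last exact/dphic/in_ball.
  by apply: is_derive_line; apply/derivableP/dphi/in_ball.
have sumS (F : 'I_n -> R) : \sum_(i < n | (i < k.+1)%N) F i =
    \sum_(i < n | (i < k)%N) F i + F i0.
  rewrite (bigD1 i0)//= addrC; congr (_ + _); apply: eq_bigl => i.
  by rewrite ltnS ltn_neqAle andbC.
rewrite !sumS /= [leRHS]mulrDr.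
set S := \sum_(i < n | _) _; set S' := \sum_(i < n | _) `|_|.
have -> : phi (w k.+1) - phi z - (S + c i0 * (y 0 i0 - z 0 i0)) =
    (phi (w k) - phi z - S) + (phi (w k.+1) - phi (w k) - c i0 * t) by rewrite /t; ring.
exact: le_trans (ler_normD _ _) (lerD (IH (ltnW kn)) inc).
Qed.

Lemma is_derive_of_partials phi x v :
  (\forall y \near x, forall i : 'I_n, derivable phi y (e_ i)) ->
  (forall i : 'I_n, {for x, continuous ('D_(e_ i) phi)}) ->
  is_derive x v phi (\sum_i v 0 i * 'D_(e_ i) phi x).
Proof.
move=> dphi cphi.
suff cvg_phi : (fun h : R => h^-1 *: ((phi \o shift x) (h *: v) - phi x)) @ 0^' -->
    \sum_i v 0 i * 'D_(e_ i) phi x.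
  by split; [apply/cvg_ex; eexists; exact: cvg_phi|exact: cvg_lim].
apply/cvgrPdist_le => eps eps0.
pose B := \sum_i `|v 0 i|.
have B0 : 0 <= B by rewrite sumr_ge0.
(* The difference quotient will be off by at most [eps' * B]; the [+ 1] covers [v = 0]. *)
pose eps' := eps / (B + 1).
have B1 : 0 < B + 1 by rewrite ltr_wpDl.
have eps'0 : 0 < eps' by rewrite divr_gt0.
have near_x : \forall y \near x, forall i : 'I_n, derivable phi y (e_ i) /\
    `|'D_(e_ i) phi y - 'D_(e_ i) phi x| <= eps'.
  have near_i : \forall y \near x, forall i : 'I_n, `|'D_(e_ i) phi y - 'D_(e_ i) phi x| <= eps'.
    have FF : Filter (nbhs x) by typeclasses eauto.
    apply: (@filter_forall _ _ _ _ FF) => i.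
    have /cvgrPdist_le/(_ _ eps'0) := cphi i.
    by apply: filterS => y; rewrite distrC.
  by apply: filterS2 dphi near_i => y H1 H2 i; split.
have [rho rho0 rhoP] := nbhs_closed_ball x _ near_x.
have rhov : 0 < rho / (`|v| + 1) by rewrite divr_gt0// ltr_wpDl.
near=> h.
have h0 : h != 0 by near: h; exact: nbhs_dnbhs_neq.
have hv : `|h *: v| <= rho.
  rewrite normrZ; apply: le_trans (_ : `|h| * (`|v| + 1) <= _).
    by rewrite ler_wpM2l// lerDl.
  rewrite -ler_pdivlMr ?ltr_wpDl//; near: h.
  by apply: dnbhs0_le.
have := @increment_gradient_le phi x (fun i => 'D_(e_ i) phi x) rho eps' _ _ (x + h *: v) x.
rewrite subrr normr0 addrAC subrr add0r => /(_ _ _ hv (ltW rho0)) H.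
have {}H : `|phi (x + h *: v) - phi x - h * \sum_i v 0 i * 'D_(e_ i) phi x| <= eps' * (`|h| * B).
  have -> : h * \sum_i v 0 i * 'D_(e_ i) phi x =
      \sum_i 'D_(e_ i) phi x * ((x + h *: v) 0 i - x 0 i).
    by rewrite mulr_sumr; apply: eq_bigr => i _; rewrite !mxE; ring.
  have -> : `|h| * B = \sum_i `|(x + h *: v) 0 i - x 0 i|.
    by rewrite mulr_sumr; apply: eq_bigr => i _; rewrite !mxE addrAC subrr add0r normrM.
  by apply: H => y i /rhoP /(_ i)[].
rewrite distrC /= [h *: v + x]addrC.
set S := \sum_i _ in H *.
have -> : h^-1 *: (phi (x + h *: v) - phi x) - S = h^-1 * (phi (x + h *: v) - phi x - h * S).
  by rewrite -[h^-1 *: _]/(h^-1 * _) [RHS]mulrBr mulKf.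
rewrite normrM normfV ler_pdivrMl ?normr_gt0//; apply: le_trans H _.
rewrite mulrCA ler_wpM2l// /eps' mulrAC ler_pdivrMr// ler_pM2l// lerDl ler01//.
Unshelve. all: by end_near. Qed.

(** The mean value estimate is used along [e_ i], its slope being estimated along [e_ j]. The second
    difference is symmetric in [i] and [j], so both mixed derivatives approximate it, whence
    [schwarz]. The bound [2 * h <= rho] covers the case [i = j]. *)
Lemma increment2_sub_le phi x i j (c rho eps h : R) :
  0 < h -> 2 * h <= rho ->
  (forall y, `|y - x| <= rho -> derivable phi y (e_ i) /\
     derivable ('D_(e_ i) phi) y (e_ j) /\
     `|'D_(e_ j) ('D_(e_ i) phi) y - c| <= eps) ->
  `|phi (x + h *: e_ i + h *: e_ j) - phi (x + h *: e_ i) - phi (x + h *: e_ j)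
     + phi x - c * h ^+ 2| <= eps * h ^+ 2.
Proof.
move=> h0 hrho H.
have in_ball s u : 0 <= s <= 1 -> 0 <= u <= 1 ->
    `|x + (s * h) *: e_ i + (u * h) *: e_ j - x| <= rho.
  move=> /andP[s0 s1] /andP[u0 u1].
  have le_h w k : 0 <= w <= 1 -> `|(w * h) *: e_ k| <= h.
    move=> /andP[w0 w1]; rewrite normrZ ger0_norm ?mulr_ge0 ?(ltW h0)//.
    rewrite -[leRHS]mulr1 ler_pM ?norm_delta_le ?mulr_ge0 ?(ltW h0)//.
    by rewrite ler_piMl// ltW.
  rewrite -[x + _ + _]addrA addrAC subrr add0r (le_trans (ler_normD _ _))//.
  apply: le_trans (lerD (le_h s i _) (le_h u j _)) _; rewrite ?s0 ?u0//.
  by rewrite -mulr2n -mulr_natl.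
pose A s := phi (x + h *: e_ j + s *: e_ i) - phi (x + s *: e_ i).
pose dA s := 'D_(e_ i) phi (x + h *: e_ j + s *: e_ i) - 'D_(e_ i) phi (x + s *: e_ i).
have I01 : 0 <= (1 : R) <= 1 by rewrite lexx ler01.
have O01 : 0 <= (0 : R) <= 1 by rewrite lexx ler01.
have dAP u : 0 <= u <= 1 -> is_derive (u * h) (1 : R) A (dA (u * h)).
  move=> u01; have b1 := in_ball u 1 u01 I01; have b2 := in_ball u 0 u01 O01.
  rewrite mul1r [x + _ + _]addrAC in b1; rewrite mul0r scale0r addr0 in b2.
  have [d1 _] := H _ b1; have [d2 _] := H _ b2.
  have {}d1 := is_derive_line _ _ _ _ _ (derivableP d1).
  have {}d2 := is_derive_line _ _ _ _ _ (derivableP d2).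
  exact: is_deriveB.
have dAc u : 0 <= u <= 1 -> `|dA (u * h) - c * h| <= eps * h.
  move=> u01.
  pose F s := 'D_(e_ i) phi (x + (u * h) *: e_ i + s *: e_ j).
  pose dF s := 'D_(e_ j) ('D_(e_ i) phi) (x + (u * h) *: e_ i + s *: e_ j).
  have dFP s : 0 <= s <= 1 -> is_derive (s * h) (1 : R) F (dF (s * h)).
    move=> s01; apply: (is_derive_line ('D_(e_ i) phi) (x + (u * h) *: e_ i) (e_ j)).
    apply: derivableP.
    by have [_ []] := H _ (in_ball u s u01 s01).
  have dFc s : 0 <= s <= 1 -> `|dF (s * h) - c| <= eps.
    by move=> s01; have [_ []] := H _ (in_ball u s u01 s01).
  have := @increment_sub_linear_le F dF h c eps dFP dFc.
  by rewrite /F scale0r addr0 (gtr0_norm h0) /dA [x + h *: _ + _]addrAC.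
have := @increment_sub_linear_le A dA h (c * h) (eps * h) dAP dAc.
rewrite (gtr0_norm h0) /A scale0r !addr0 -!mulrA -expr2 [x + h *: _ + _]addrAC.
by congr (`|_ - _| <= _); ring.
Qed.

Lemma nbhs_ball_control (P : set 'rV[R]_n) (f1 f2 : 'rV[R]_n -> R) x (e : R) : 0 < e ->
  nbhs x P -> {for x, continuous f1} -> {for x, continuous f2} ->
  exists2 rho : R, 0 < rho & forall y, `|y - x| <= rho ->
    P y /\ (`|f1 y - f1 x| <= e /\ `|f2 y - f2 x| <= e).
Proof.
move=> e0 xP /cvgrPdist_le/(_ _ e0) c1 /cvgrPdist_le/(_ _ e0) c2.
apply: (nbhs_closed_ball x (fun y => P y /\ (`|f1 y - f1 x| <= e /\ `|f2 y - f2 x| <= e))).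
by apply: filterS3 xP c1 c2 => y H1; rewrite distrC => H2; rewrite distrC => H3.
Qed.

Lemma schwarz phi x i j :
  (\forall y \near x, [/\ derivable phi y (e_ i), derivable phi y (e_ j),
     derivable ('D_(e_ i) phi) y (e_ j) & derivable ('D_(e_ j) phi) y (e_ i)]) ->
  {for x, continuous ('D_(e_ j) ('D_(e_ i) phi))} ->
  {for x, continuous ('D_(e_ i) ('D_(e_ j) phi))} ->
  'D_(e_ j) ('D_(e_ i) phi) x = 'D_(e_ i) ('D_(e_ j) phi) x.
Proof.
have arith (a b p q r t k e : R) : 0 < k -> `|p - q - r + t - a * k| <= e / 2 * k ->
    `|p - r - q + t - b * k| <= e / 2 * k -> `|b - a| <= e.
  move=> k0 H1 H2; rewrite -(ler_pM2r k0) -{1}(gtr0_norm k0) -normrM.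
  by move: H1 H2; rewrite !ler_norml; lra.
move=> dphi c1 c2; apply/eqP; rewrite -subr_eq0 -normr_le0.
apply/ler_addgt0Pr => e e0; rewrite add0r.
have e20 : 0 < e / 2 by rewrite divr_gt0.
have [rho rho0 rhoP] := nbhs_ball_control _ _ _ _ _ e20 dphi c1 c2.
have h0 : 0 < rho / 2 by rewrite divr_gt0.
have hrho : 2 * (rho / 2) <= rho by rewrite mulrCA divff ?mulr1.
have := @increment2_sub_le phi x i j _ rho (e / 2) (rho / 2) h0 hrho
  (fun y yx => let: conj (And4 d1 d2 d3 d4) (conj a1 a2) := rhoP y yx in conj d1 (conj d3 a1)).
have := @increment2_sub_le phi x j i _ rho (e / 2) (rho / 2) h0 hrho
  (fun y yx => let: conj (And4 d1 d2 d3 d4) (conj a1 a2) := rhoP y yx in conj d2 (conj d4 a2)).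
set a := 'D_(e_ i) ('D_(e_ j) phi) x; set b := 'D_(e_ j) ('D_(e_ i) phi) x.
rewrite [x + _ *: e_ j + _]addrAC => H1 H2.
have h20 : 0 < (rho / 2) ^+ 2 by rewrite exprn_gt0.
exact: arith h20 H1 H2.
Qed.

End SeveralVariables.

(** * Words in the coordinates and multinomial coefficients *)

Section Words.
Context {n : nat}.

(** Differentiating along a vector prepends a letter, so words make the recursion for directional
    derivatives immediate; multinomial coefficients enter only through [count_words]. *)
Fixpoint words (j : nat) : seq (seq 'I_n) :=
  if j is k.+1 then [seq i :: s | i <- enum 'I_n, s <- words k] else [:: [::]].

Lemma size_words j s : s \in words j -> size s = j.
Proof.
elim: j s => [|j IH] s /=; first by rewrite inE => /eqP ->.
by case/allpairsP => -[i t] /= [_ /IH <- ->].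
Qed.

Lemma sum_count_words j (s : seq 'I_n) : s \in words j -> (\sum_i count_mem i s = j)%N.
Proof.
move=> /size_words <-; elim: s => [|k s IH] /=; first by rewrite big1.
rewrite big_split /= IH -[RHS]add1n; congr addn.
by rewrite (bigD1 k)//= eqxx big1 ?addn0// => i; rewrite eq_sym => /negbTE ->.
Qed.

Definition has_content (alpha : 'I_n -> nat) (s : seq 'I_n) : bool :=
  [forall i, count_mem i s == alpha i].

(** Recursion on the first letter: dropping a first letter [i] lowers [alpha i] by one, so in length
    j + 1 the words starting with [i] contribute [alpha i] times j!, and the [alpha i] add up to j +
    1. *)
Lemma count_words j (alpha : 'I_n -> nat) : (\sum_i alpha i = j)%N ->
  (count (has_content alpha) (words j) * \prod_i (alpha i)`! = j`!)%N.
Proof.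
elim: j alpha => [|j IH] alpha sum_alpha.
  have alpha0 i : alpha i = 0%N.
    by move/eqP: sum_alpha; rewrite sum_nat_eq0 => /forallP/(_ i)/eqP.
  rewrite big1 => [|i _]; last by rewrite alpha0.
  rewrite /= /has_content; have -> // : [forall i, count_mem i [::] == alpha i].
  by apply/forallP => i; rewrite alpha0.
rewrite /= -sum1_count big_mkcond big_allpairs_dep big_enum big_distrl /=.
rewrite factS -sum_alpha big_distrl /=; apply: eq_bigr => i _.
rewrite -big_mkcond sum1_count.
have [alpha_i|alpha_i] := posnP (alpha i).
  rewrite alpha_i mul0n; apply/eqP; rewrite muln_eq0 -leqn0 leqNgt -has_count.
  apply/orP; left; apply/hasPn => s _; apply/negP => /forallP/(_ i)/=.
  by rewrite eqxx alpha_i.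
pose alpha' k := (alpha k - (k == i))%N.
have alphaE k : alpha k = ((i == k) + alpha' k)%N.
  by rewrite /alpha' [i == k]eq_sym subnKC//; case: eqVneq => // ->.
rewrite (@eq_count _ _ (has_content alpha')); last first.
  by move=> s; apply: eq_forallb => k /=; rewrite alphaE eqn_add2l.
have sum_alpha' : (\sum_i alpha' i = j)%N.
  move: sum_alpha; rewrite (eq_bigr _ (fun k _ => alphaE k)) big_split /=.
  rewrite (bigD1 i)//= eqxx big1 ?addn0 ?add1n; first by case.
  by move=> k; rewrite eq_sym => /negbTE ->.
rewrite -(IH _ sum_alpha') mulnCA; congr muln.
rewrite (bigD1 i)//= [in RHS](bigD1 i)//= mulnA; congr muln.
  by rewrite /alpha' eqxx subn1 -{1}(prednK alpha_i) factS prednK.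
by apply: eq_bigr => k /negbTE ki; rewrite /alpha' ki subn0.
Qed.

End Words.

(** * Iterated partial and directional derivatives of a function of class C^p *)

Section PartialDerivatives.
Context {R : realType} {n : nat}.
Variables (p : nat) (g : 'rV[R]_n -> R) (U : set 'rV[R]_n).
Hypotheses (U_open : open U) (gC : class_C (p%:R%:E) g U).
Implicit Types (x y v : 'rV[R]_n) (s : seq 'I_n).

Local Notation e_ i := (delta_mx 0 i : 'rV[R]_n).

Lemma pderiv_continuous s x : (size s <= p)%N -> U x -> {for x, continuous (pderiv s g)}.
Proof. by move=> sp; apply: gC.1; rewrite lee_fin ler_nat. Qed.

Lemma pderiv_derivable s i x : (size s < p)%N -> U x -> derivable (pderiv s g) x (e_ i).
Proof. by move=> sp; apply: gC.2; rewrite lee_fin ler_nat. Qed.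

Lemma pderiv_cons_eq i s t x : (forall y, U y -> pderiv s g y = pderiv t g y) -> U x ->
  pderiv (i :: s) g x = pderiv (i :: t) g x.
Proof.
move=> st Ux; apply: near_eq_derive.
by have := open_nbhs_nbhs (conj U_open Ux); apply: filterS.
Qed.

Lemma pderiv_swap i j s x : (size s + 2 <= p)%N -> U x ->
  pderiv [:: i, j & s] g x = pderiv [:: j, i & s] g x.
Proof.
rewrite addn2 => sp Ux; apply: schwarz.
- have := open_nbhs_nbhs (conj U_open Ux); apply: filterS => y Uy; split.
  + by apply: pderiv_derivable => //; apply: ltn_trans sp.
  + by apply: pderiv_derivable => //; apply: ltn_trans sp.
  + exact: (pderiv_derivable (j :: s)).
  + exact: (pderiv_derivable (i :: s)).
- exact: (pderiv_continuous [:: i, j & s]).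
- exact: (pderiv_continuous [:: j, i & s]).
Qed.

Lemma pderiv_move i s t x : (size s + size t < p)%N -> U x ->
  pderiv (s ++ i :: t) g x = pderiv (i :: s ++ t) g x.
Proof.
elim: s x => [|k s IH] x sp Ux; first by [].
have size_le : (size s + size t < p)%N by apply: leq_ltn_trans sp; rewrite leq_add2r.
transitivity (pderiv [:: k, i & s ++ t] g x).
  exact: (pderiv_cons_eq _ _ _ _ (fun y Uy => IH y size_le Uy) Ux).
by apply: pderiv_swap Ux; rewrite size_cat addn2.
Qed.

Lemma pderiv_perm s t x : perm_eq s t -> (size s <= p)%N -> U x ->
  pderiv s g x = pderiv t g x.
Proof.
elim: s t x => [|i s IH] t x.
  by move=> /perm_size/esym/size0nil ->.
move=> st sp Ux.
have it : i \in t by rewrite -(perm_mem st) mem_head.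
have {it} [t1 [t2 tE]] : exists t1 t2, t = t1 ++ i :: t2.
  by case/splitPr: it => t1 t2; exists t1, t2.
have st' : perm_eq s (t1 ++ t2).
  by rewrite -(perm_cons i) (perm_trans st)// tE -cat1s perm_catCA.
have size_lt : (size t1 + size t2 < p)%N by rewrite -size_cat -(perm_size st').
rewrite tE (pderiv_move _ _ _ _ size_lt Ux).
exact: (pderiv_cons_eq _ _ _ _ (fun y Uy => IH _ _ st' (ltnW sp) Uy) Ux).
Qed.

Lemma mderivativeE (alpha : 'I_n -> nat) s x : has_content alpha s -> (size s <= p)%N ->
  U x -> mderivative alpha g x = pderiv s g x.
Proof.
move=> /forallP sa sp Ux; apply/esym/pderiv_perm => //.
apply/allP => k _ /=; rewrite (eqP (sa k)) count_flatten -map_comp sumnE big_map big_enum /=.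
rewrite (bigD1 k)//= count_nseq /= eqxx mul1n big1 ?addn0// => i ik.
by rewrite count_nseq /= (negbTE ik) mul0n.
Qed.

(** By symmetry of mixed derivatives, the derivative along a word depends only on its content, and
    j!/alpha! words share the content [alpha]. *)
Lemma sum_words_pderiv j x : (j <= p)%N -> U x ->
  \sum_(s <- words j) `|pderiv s g x| = deriv_size g j x.
Proof.
move=> jp Ux.
pose content s : {ffun 'I_n -> 'I_j.+1} := [ffun i => inord (count_mem i s)].
have contentE s i : s \in words j -> content s i = count_mem i s :> nat.
  by move=> /size_words sj; rewrite ffunE inordK// ltnS -sj count_size.
rewrite big_seq (partition_big content (fun alpha : {ffun 'I_n -> 'I_j.+1} =>
    (\sum_i alpha i == j)%N)) /=; last first.
  move=> s sj; apply/eqP; rewrite -[RHS](sum_count_words _ _ sj).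
  by apply: eq_bigr => i _; rewrite contentE.
apply: eq_bigr => alpha /eqP sum_alpha.
have content_eq s : s \in words j -> (content s == alpha) = has_content (fun i => alpha i) s.
  move=> sj; apply/eqP/forallP => [<- i|sa]; first by rewrite contentE.
  by apply/ffunP => i; apply/val_inj; rewrite /= contentE// (eqP (sa i)).
rewrite (eq_bigr (fun=> `|mderivative (fun i => alpha i) g x|)); last first.
  move=> s /andP[sj]; rewrite content_eq// => sa.
  by rewrite (mderivativeE _ s)// (size_words _ _ sj).
rewrite -big_filter big_const_seq count_predT size_filter.
rewrite (@eq_in_count _ _ (has_content (fun i => alpha i))); last first.
  by move=> s sj; rewrite sj content_eq.
rewrite iter_addr_0 -[LHS]mulr_natl; congr (_ * _).
have := count_words _ _ sum_alpha => /(congr1 (fun k => k%:R : R)) /=.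
rewrite natrM => <-; rewrite mulfK// pnatr_eq0 -lt0n.
by rewrite prodn_gt0// => i; rewrite fact_gt0.
Qed.

Definition dir_deriv v j x : R :=
  \sum_(s <- words j) (\prod_(i <- s) v 0 i) * pderiv s g x.

Lemma dir_deriv0 v x : dir_deriv v 0 x = g x.
Proof. by rewrite /dir_deriv /= big_seq1 big_nil mul1r. Qed.

Lemma is_derive_big_seq (T : eqType) (r : seq T) (c : T -> R) (F : T -> 'rV[R]_n -> R)
    (dF : T -> R) x v :
  (forall t, t \in r -> is_derive x v (F t) (dF t)) ->
  is_derive x v (fun y => \sum_(t <- r) c t * F t y) (\sum_(t <- r) c t * dF t).
Proof.
elim: r => [|t r IH] dFP.
  rewrite big_nil (_ : (fun _ => _) = cst 0); first exact: is_derive_cst.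
  by apply/funext => y; rewrite big_nil.
rewrite big_cons (_ : (fun _ => _) = (c t *: F t) + (fun y => \sum_(t <- r) c t * F t y)).
  have dt := dFP t (mem_head _ _).
  have dr : is_derive x v (fun y => \sum_(t <- r) c t * F t y) (\sum_(t <- r) c t * dF t).
    by apply: IH => u ur; apply: dFP; rewrite inE ur orbT.
  exact: is_deriveD.
by apply/funext => y; rewrite big_cons.
Qed.

Lemma is_derive_dir_deriv v j x : (j < p)%N -> U x ->
  is_derive x v (dir_deriv v j) (dir_deriv v j.+1 x).
Proof.
move=> jp Ux.
have := is_derive_big_seq _ (words j) (fun s => \prod_(i <- s) v 0 i) (fun s => pderiv s g)
  (fun s => \sum_i v 0 i * pderiv (i :: s) g x) x v.
have -> : \sum_(s <- words j) (\prod_(i <- s) v 0 i) * (\sum_i v 0 i * pderiv (i :: s) g x) =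
    dir_deriv v j.+1 x.
  rewrite /dir_deriv /= big_allpairs_dep big_enum /= exchange_big /=.
  apply: eq_bigr => s _; rewrite mulr_sumr; apply: eq_bigr => i _.
  by rewrite big_cons mulrA [X in X * _]mulrC.
apply=> s /size_words sj; apply: is_derive_of_partials.
  have := open_nbhs_nbhs (conj U_open Ux); apply: filterS => y Uy i.
  by apply: pderiv_derivable Uy; rewrite sj.
by move=> i; apply: (pderiv_continuous (i :: s)) Ux; rewrite /= sj.
Qed.

Lemma dir_deriv_continuous v j x : (j <= p)%N -> U x -> {for x, continuous (dir_deriv v j)}.
Proof.
move=> jp Ux.
suff key r : {subset r <= words j} ->
    {for x, continuous (fun y => \sum_(s <- r) (\prod_(i <- s) v 0 i) * pderiv s g y)}.
  exact: key.
elim: r => [_|s r IH sub].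
  rewrite (_ : (fun _ => _) = cst 0); first exact: cst_continuous.
  by apply/funext => y; rewrite big_nil.
rewrite (_ : (fun _ => _) = (fun y => (\prod_(i <- s) v 0 i) * pderiv s g y) +
  (fun y => \sum_(s <- r) (\prod_(i <- s) v 0 i) * pderiv s g y)); last first.
  by apply/funext => y; rewrite big_cons.
apply: continuousD; last by apply: IH => t tr; apply: sub; rewrite inE tr orbT.
apply: continuousM; first exact: cst_continuous.
by apply: pderiv_continuous Ux; rewrite (size_words j)// sub ?mem_head.
Qed.

Lemma dir_deriv_le v (a : R) j x : (forall i, `|v 0 i| <= a) -> (j <= p)%N -> U x ->
  `|dir_deriv v j x| <= a ^+ j * deriv_size g j x.
Proof.
move=> va jp Ux; rewrite -(sum_words_pderiv _ _ jp Ux) mulr_sumr.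
apply: le_trans (ler_norm_sum _ _ _) _; rewrite !big_seq; apply: ler_sum => s /size_words sj.
rewrite normrM ler_wpM2r// -sj; elim: s {sj} => [|i s IH].
  by rewrite big_nil normr1.
by rewrite big_cons normrM exprS ler_pM.
Qed.

End PartialDerivatives.

(** * Many points of a set of positive measure near one line *)

Section Pigeonhole.
Context {R : realType}.

Lemma leb_le_cubes {n} (E : set 'rV[R]_n.+1) (r : seq 'rV[R]_n.+1) (sigma : R) :
  0 <= sigma ->
  (forall y, E y -> exists2 a, a \in r & forall i, a 0 i <= y 0 i <= a 0 i + sigma) ->
  (leb E <= ((size r)%:R * sigma ^+ n.+1)%:E)%E.
Proof.
move=> sigma0 Er.
(* Past the end of [r] the boxes degenerate to points, of volume [0 ^+ n.+1 = 0]. *)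
pose side k : R := if (k < size r)%N then sigma else 0.
have side0 k : 0 <= side k by rewrite /side; case: ifP.
pose a k : 'rV[R]_n.+1 := nth 0 r k.
pose b k : 'rV[R]_n.+1 := \row_i (a k 0 i + side k).
have sideE k : \prod_(i < n.+1) (b k 0 i - a k 0 i) = side k ^+ n.+1.
  rewrite (eq_bigr (fun=> side k)); first by rewrite prodr_const card_ord.
  by move=> i _; rewrite mxE addrAC subrr add0r.
apply: le_trans (_ : (\sum_(0 <= k <oo) (\prod_(i < n.+1) (b k 0 i - a k 0 i))%:E <= _)%E).
  apply: ereal_inf_lbound; exists a, b; split=> //.
  - by move=> k i; rewrite mxE lerDl.
  - move=> y /Er[c cr cP]; exists (index c r) => // i.
    by rewrite mxE /a /side index_mem cr nth_index.
apply: lime_le.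
  by apply: is_cvg_nneseries => k _ _; rewrite sideE lee_fin exprn_ge0.
apply: nearW => m; rewrite sumEFin lee_fin.
rewrite (eq_bigr _ (fun k _ => sideE k)).
have -> : \sum_(0 <= k < m) side k ^+ n.+1 = (minn m (size r))%:R * sigma ^+ n.+1.
  elim: m => [|m IH]; first by rewrite big_geq// min0n mul0r.
  rewrite big_nat_recr//= IH /side; case: ltnP => mr.
    by rewrite (minn_idPl mr) -natr1 mulrDl mul1r.
  by rewrite (minn_idPr (leqW mr)) expr0n addr0.
by rewrite ler_wpM2r ?exprn_ge0// ler_nat geq_minr.
Qed.

Lemma sorted_ltn_gap (s : seq nat) i h : sorted ltn s -> (i + h < size s)%N ->
  (nth 0 s i + h <= nth 0 s (i + h))%N.
Proof.
move=> s_sorted; elim: h => [|h IH] ih; first by rewrite !addn0.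
rewrite !addnS in ih *; apply: leq_ltn_trans (IH (ltnW ih)) _.
apply: (sorted_ltn_nth ltn_trans) => //; exact: ltnW ih.
Qed.

(* The coordinates [t] along [v] and [w] transverse to [v] are cut into cells of
   size [eta]; [E] meets so many cells that some tube [w = const] contains more
   than [h * k] of them, and every [h]-th is kept. *)
Lemma points_near_line {n} (v : 'rV[R]_n.+1) (k : nat) : v != 0 -> (0 < k)%N ->
  exists2 C : R, 0 < C & forall x (E : set 'rV[R]_n.+1) (m eta0 : R),
    0 < m -> 0 < eta0 -> (forall y, E y -> `|y - x| <= 1) -> (m%:E <= leb E)%E ->
    exists (z : nat -> 'rV[R]_n.+1) (t : nat -> R),
      (forall i, (i < k)%N -> E (z i) /\ `|z i - z 0%N - (t i - t 0%N) *: v| <= eta0) /\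
      (forall i, (i.+1 < k)%N -> t i + m / C <= t i.+1).
Proof.
move=> v0 k0.
have /existsP[i0 vi0] : [exists i, v 0 i != 0].
  apply: contraNT v0 => /existsPn H; apply/eqP/rowP => i; rewrite mxE.
  by apply/eqP; have := H i; rewrite negbK.
pose V := `|v|; pose T := `|v 0 i0|^-1.
have V0 : 0 <= V by exact: normr_ge0.
have T0 : 0 <= T by rewrite invr_ge0.
pose D := 1 + T * V; pose D' := 2 * D + 1.
have D0 : 0 < D by rewrite ltr_pwDl// mulr_ge0.
have D'0 : 0 < D' by rewrite /D'; lra.
(* There will be at most [(D' / eta) ^ n] tubes, and each cell fits in a cube of side
   [(1 + 2 * V) * eta]. If every tube met at most [h * k] cells, the measure would be at most
   [C0 * (h * eta) * k]: apart from the spacing [h * eta], the powers of [eta] cancel. *)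
pose C0 := D' ^+ n * (1 + 2 * V) ^+ n.+1.
have C00 : 0 < C0 by rewrite mulr_gt0// exprn_gt0// ltr_pwDl// mulr_ge0.
have kR : 0 < k%:R :> R by rewrite ltr0n.
exists (4 * C0 * k%:R); first by rewrite mulr_gt0// mulr_gt0.
move=> x E m eta0 m0 eta00 Ex mE.
(* Target spacing, chosen so that [C0 * (g * k) = m / 2] is less than the measure of [E]. *)
pose g := m / (2 * C0 * k%:R).
have g0 : 0 < g by rewrite divr_gt0// mulr_gt0// mulr_gt0.
(* The bound [1] enters the count of tubes and [eta0] limits the transverse spread. Rounding loses
   at most [2 * eta <= g / 2] of the spacing [g], which leaves [g / 2 = m / C]. *)
pose eta := Num.min (Num.min 1 eta0) (g / 4).
have eta_gt0 : 0 < eta by rewrite !lt_min ltr01 eta00 divr_gt0.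
have eta1 : eta <= 1 by rewrite /eta !ge_min lexx.
have eta_eta0 : eta <= eta0 by rewrite /eta !ge_min lexx orbT.
have etag : eta <= g / 4 by rewrite /eta !ge_min lexx !orbT.
(* Oblique coordinates: [tc] is read off the coordinate [i0], where [wc] then vanishes, so only [n]
   transverse coordinates remain. *)
pose tc (y : 'rV[R]_n.+1) : R := (y 0 i0 - x 0 i0) / v 0 i0.
pose wc (y : 'rV[R]_n.+1) : 'rV[R]_n.+1 := y - x - tc y *: v.
have wc_i0 y : wc y 0 i0 = 0 by rewrite !mxE /tc divfK// subrr.
have tcT y : E y -> `|tc y| <= T.
  move=> Ey; rewrite normrM normfV -[leRHS]mul1r ler_wpM2r ?invr_ge0//.
  by have := le_trans (coord_le_norm _ i0) (Ex _ Ey); rewrite !mxE.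
have wcD y : E y -> `|wc y| <= D.
  move=> Ey; apply: le_trans (ler_normB _ _) _; rewrite normrZ lerD// ?Ex//.
  by rewrite ler_wpM2r// tcT.
have cell_itv (u M : R) : `|u| <= M ->
    (Num.truncn ((u + M) / eta))%:R * eta - M <= u <=
    (Num.truncn ((u + M) / eta))%:R * eta - M + eta.
  move=> /ler_normlP[uM1 uM2].
  have uM0 : 0 <= (u + M) / eta by apply: divr_ge0; [lra|exact: ltW].
  have /andP[] := truncn_itv uM0.
  rewrite ler_pdivlMr// ltr_pdivrMr// -natr1 => H1 H2.
  by apply/andP; split; lra.
pose B := Num.truncn (2 * D / eta); pose L := Num.truncn (2 * T / eta).
pose cell y : {ffun 'I_n -> 'I_B.+1} :=
  [ffun j => inord (Num.truncn ((wc y 0 (lift i0 j) + D) / eta))].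
pose lev y := Num.truncn ((tc y + T) / eta).
have cellE y j : E y -> cell y j = Num.truncn ((wc y 0 (lift i0 j) + D) / eta) :> nat.
  move=> Ey; rewrite ffunE inordK// ltnS; apply: le_truncn.
  rewrite ler_pM2r ?invr_gt0//.
  have := le_trans (coord_le_norm _ (lift i0 j)) (wcD _ Ey); rewrite ler_norml; lra.
have levL y : E y -> (lev y < L.+1)%N.
  move=> Ey; rewrite ltnS; apply: le_truncn; rewrite ler_pM2r ?invr_gt0//.
  by have := tcT _ Ey; rewrite ler_norml; lra.
pose hit c l := `[< exists2 y, E y & cell y = c /\ lev y = l >].
pose levels c := [seq l <- iota 0 L.+1 | hit c l].
pose low (c : {ffun 'I_n -> 'I_B.+1}) (i : 'I_n.+1) : R :=
  if unlift i0 i is Some j then (c j)%:R * eta - D else 0.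
(* A cell is slanted along [v]: inside it the multiple of [v] moves each coordinate by at most
   [eta * V] in either direction, whence the shift here and the side [sigma]. *)
pose corner (c : {ffun 'I_n -> 'I_B.+1}) (l : nat) : 'rV[R]_n.+1 :=
  \row_i (x 0 i + low c i + (l%:R * eta - T) * v 0 i - eta * V).
pose r := [seq corner c l | c <- enum {ffun 'I_n -> 'I_B.+1}, l <- levels c].
pose sigma := eta * (1 + 2 * V).
have cover y : E y -> exists2 a, a \in r & forall i, a 0 i <= y 0 i <= a 0 i + sigma.
  move=> Ey; exists (corner (cell y) (lev y)).
    apply/allpairsPdep; exists (cell y), (lev y); split=> //; first by rewrite mem_enum.
    rewrite mem_filter mem_iota /= add0n (levL _ Ey) andbT.
    by apply/asboolP; exists y.
  move=> i; rewrite mxE.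
  have /andP[t1 t2] := cell_itv _ _ (tcT _ Ey).
  set s := (lev y)%:R * eta - T.
  have {}t1 : 0 <= tc y - s by rewrite subr_ge0.
  have {}t2 : tc y - s <= eta by rewrite lerBlDl.
  have sv : `|(tc y - s) * v 0 i| <= eta * V.
    by rewrite normrM ger0_norm// ler_pM// coord_le_norm.
  have -> : y 0 i = x 0 i + wc y 0 i + tc y * v 0 i by rewrite !mxE; ring.
  have w_itv : 0 <= wc y 0 i - low (cell y) i <= eta.
    rewrite /low; case: unliftP => [j ->|->]; last by rewrite wc_i0 subrr lexx ltW.
    rewrite cellE//.
    have := cell_itv _ _ (le_trans (coord_le_norm _ (lift i0 j)) (wcD _ Ey)).
    by move=> /andP[w1 w2]; apply/andP; split; lra.
  move: w_itv sv; rewrite ler_norml /sigma.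
  move=> /andP[w1 w2] /andP[s1 s2].
  have -> : x 0 i + wc y 0 i + tc y * v 0 i =
    x 0 i + wc y 0 i + s * v 0 i + (tc y - s) * v 0 i by ring.
  by apply/andP; split; lra.
have sigma0 : 0 < sigma by rewrite mulr_gt0// ltr_pwDl// mulr_ge0.
have size_r := le_trans mE (leb_le_cubes E r sigma (ltW sigma0) cover).
pose h := Num.truncn (g / eta).
have /andP[h1 h2] : h%:R * eta <= g < h%:R * eta + eta.
  have := truncn_itv (ltW (divr_gt0 g0 eta_gt0)).
  rewrite -/h ler_pdivlMr// ltr_pdivrMr// -natr1 => /andP[H1 H2].
  by apply/andP; split; lra.
have [c hc] : exists c, (h * k < size (levels c))%N.
  apply: contrapT => /forallNP H; move: size_r; apply/negP; rewrite -ltNge lte_fin.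
  have size_le : (size r <= (B.+1 ^ n) * (h * k))%N.
    rewrite size_allpairs_dep sumnE big_map.
    have -> : (B.+1 ^ n = #|{ffun 'I_n -> 'I_B.+1}|)%N by rewrite card_ffun !card_ord.
    rewrite cardE -sum1_size big_distrl /=; apply: leq_sum => c _.
    by rewrite mul1n leqNgt; apply/negP/H.
  have eqE : ((B.+1 ^ n) * (h * k))%N%:R * sigma ^+ n.+1 =
      (B.+1%:R * eta) ^+ n * (1 + 2 * V) ^+ n.+1 * (h%:R * eta * k%:R).
    by rewrite !natrM natrX /sigma !exprMn [eta ^+ n.+1]exprS; ring.
  have Beta : B.+1%:R * eta <= D'.
    have B0 : 0 <= 2 * D / eta by apply: divr_ge0; [lra|exact: ltW].
    have /andP[] := truncn_itv B0; rewrite -/B ler_pdivlMr// -natr1 /D' => ? _; lra.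
  have V12 : 0 <= (1 + 2 * V) ^+ n.+1 by rewrite exprn_ge0//; lra.
  have le1 : (B.+1%:R * eta) ^+ n * (1 + 2 * V) ^+ n.+1 <= C0.
    rewrite ler_wpM2r//; apply: lerXn2r => //; rewrite nnegrE.
      by rewrite mulr_ge0// ltW.
    exact: ltW.
  have le2 : h%:R * eta * k%:R <= g * k%:R by rewrite ler_wpM2r.
  have : (size r)%:R * sigma ^+ n.+1 <= C0 * (g * k%:R).
    apply: le_trans (_ : ((B.+1 ^ n) * (h * k))%N%:R * sigma ^+ n.+1 <= _).
      by rewrite ler_wpM2r ?ler_nat// exprn_ge0// ltW.
    rewrite eqE ler_pM// ?mulr_ge0// ?exprn_ge0// ?mulr_ge0// ltW//.
  have -> : C0 * (g * k%:R) = m / 2.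
    by rewrite /g; field; rewrite !lt0r_neq0.
  lra.
have s_sorted : sorted ltn (levels c).
  by apply: sorted_filter; [exact: ltn_trans|exact: iota_ltn_sorted].
have idx i : (i < k)%N -> (i * h < size (levels c))%N.
  move=> ik; apply: leq_ltn_trans hc; rewrite mulnC leq_mul2l ltnW ?orbT//.
have {}/choice[z zP] : forall i, exists y, (i < k)%N ->
    E y /\ cell y = c /\ lev y = nth 0%N (levels c) (i * h).
  move=> i; have [ik|_] := boolP (i < k)%N; last by exists 0.
  have := mem_nth 0%N (idx _ ik); rewrite mem_filter => /andP[/asboolP[y Ey [yc yl]] _].
  by exists y => _.
exists z, (fun i => tc (z i)); split=> [i ik|i ik].
  have [Ei [ci _]] := zP i ik; have [Ez [cz _]] := zP 0%N k0; split=> //.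
  have -> : z i - z 0%N - (tc (z i) - tc (z 0%N)) *: v = wc (z i) - wc (z 0%N).
    by apply/rowP => j; rewrite !mxE; ring.
  apply: le_trans eta_eta0; apply: norm_le_coord => [|j]; first exact: ltW.
  have -> : (wc (z i) - wc (z 0%N)) 0 j = wc (z i) 0 j - wc (z 0%N) 0 j by rewrite !mxE.
  have [j' ->|->] := unliftP i0 j; last by rewrite !wc_i0 subrr normr0 ltW.
  have /andP[a1 a2] := cell_itv _ _ (le_trans (coord_le_norm _ (lift i0 j')) (wcD _ Ei)).
  have /andP[b1 b2] := cell_itv _ _ (le_trans (coord_le_norm _ (lift i0 j')) (wcD _ Ez)).
  by move: a1 a2 b1 b2; rewrite -!cellE// ci cz ler_norml => *; apply/andP; split; lra.
have [Ei [_ li]] := zP i (ltnW ik); have [Ej [_ lj]] := zP i.+1 ik.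
have gap : (lev (z i) + h <= lev (z i.+1))%N.
  rewrite li lj mulSn [(h + _)%N]addnC; apply: sorted_ltn_gap => //.
  by rewrite addnC -mulSn idx.
have /andP[a1 a2] := cell_itv _ _ (tcT _ Ei); have /andP[b1 b2] := cell_itv _ _ (tcT _ Ej).
move: gap; rewrite -(ler_nat R) natrD -(ler_pM2r eta_gt0) mulrDl => gap.
have -> : m / (4 * C0 * k%:R) = g / 2.
  by rewrite /g; field; rewrite !lt0r_neq0.
by move: a1 a2 b1 b2 gap; rewrite -/(lev _) -/(lev _); lra.
Qed.

End Pigeonhole.

(** * Comparison of the sup norm, the Euclidean norm and the diameter *)

Section EuclideanNorm.
Context {R : realType} {n : nat}.
Implicit Types (x y : 'rV[R]_n) (K : set 'rV[R]_n).

Lemma coord_le_enorm x i : `|x 0 i| <= enorm x.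
Proof.
rewrite -sqrtr_sqr ler_sqrt; last by rewrite sumr_ge0// => k _; exact: sqr_ge0.
by rewrite (bigD1 i)//= lerDl sumr_ge0// => k _; exact: sqr_ge0.
Qed.

Lemma norm_le_enorm x : `|x| <= enorm x.
Proof. by apply: norm_le_coord => [|i]; [exact: sqrtr_ge0|exact: coord_le_enorm]. Qed.

Lemma enorm_le_diam K x y : compact K -> K x -> K y -> enorm (x - y) <= diam K.
Proof.
move=> /compact_bounded[B [_ KB]] Kx Ky.
have {}KB z : K z -> `|z| <= B + 1 by apply: KB; rewrite ltrDl.
apply: ub_le_sup; last by exists x => //; exists y.
exists (Num.sqrt (\sum_(i < n) ((B + 1) + (B + 1)) ^+ 2)) => _ [u Ku [z Kz <-]].
rewrite ler_wsqrtr//; apply: ler_sum => i _.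
rewrite -[leLHS]real_normK ?num_real//.
have le_B : `|(u - z) 0 i| <= (B + 1) + (B + 1).
  apply: le_trans (coord_le_norm _ _) _; apply: le_trans (ler_normB _ _) _.
  by rewrite lerD ?KB.
by rewrite lerXn2r// nnegrE// (le_trans _ le_B).
Qed.

Lemma diam_le_aconst d K : diam K <= aconst d K.
Proof.
rewrite /aconst; case: ifP => // d2.
have max1 : 1 <= Num.max (diam K) 1 by rewrite le_max lexx orbT.
have maxd : diam K <= Num.max (diam K) 1 by rewrite le_max lexx.
apply: le_trans maxd _; rewrite ler_peMl ?(le_trans ler01)//.
have q1 : 1 <= d.+1%:R ^+ d.+1 / d.-1%:R ^+ d.-1 :> R.
  have d1 : (0 < d.-1)%N by case: d d2 => [|[]].
  rewrite ler_pdivlMr ?exprn_gt0 ?ltr0n// mul1r -!natrX ler_nat.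
  apply: leq_trans (_ : d.+1 ^ d.-1 <= _)%N.
    by rewrite leq_exp2r// (leq_trans (leq_pred d)).
  by rewrite leq_pexp2l// (leq_trans (leq_pred d)).
lra.
Qed.

End EuclideanNorm.

(** * The starting index and the degree N *)

Section BangDegree.
Context {R : realType}.
Implicit Types (mu : nat -> R) (A a b : R).

Lemma start_index_exp A b : 0 < A -> 0 < b ->
  expR (- (start_index A b)%:R) * A <= b.
Proof.
move=> A0 b0; rewrite /start_index; case: ex_minnP => j lnj _.
rewrite -ler_pdivlMr// -[leRHS]lnK ?posrE ?divr_gt0// ler_expR.
by rewrite -[b / A]invrK invfM invrK mulrC lnV ?posrE ?divr_gt0// lerN2.
Qed.

Lemma start_index_gt0 A b : 0 < b -> b < A -> (0 < start_index A b)%N.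
Proof.
move=> b0 bA; rewrite /start_index; case: ex_minnP => -[|//] + _.
by rewrite leNgt ln_gt0// ltr_pdivlMr// mul1r.
Qed.

(** The index [k + 1] is the first at which the partial sum reaches e; it exists because
    admissibility puts the series of the [(mu j)^-1] above a e. Thus the supremum is attained at
    [k], and [k] is at least the starting index because empty sums are below e. *)
Lemma degN_nat mu A a b : (forall j, 0 < mu j.+1) -> admissible_tuple mu A a b ->
  exists k : nat, [/\ (start_index A b <= k)%N, degN mu A a b = (2 * k)%N%:R%:E &
    expR 1 <= \sum_((start_index A b).+1 <= j < k.+2) (a * mu j)^-1].
Proof.
move=> mu0 [A0 a0 b0 sum_gt]; rewrite /degN; set j0 := start_index A b in sum_gt *.
pose S k := \sum_(j0.+1 <= j < k.+1) (a * mu j)^-1.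
have term_ge0 j : (j0 < j)%N -> 0 <= (mu j)^-1 by case: j => // j _; rewrite invr_ge0 ltW.
have S_homo k l : (k <= l)%N -> S k <= S l.
  apply: (@homo_leq R S (fun x y => x <= y)) => {k l} [l|y x z|l]; [exact: lexx|exact: le_trans|].
  have [j0l|lj0] := leqP j0 l; last first.
    by rewrite /S !big_geq ?ltnS ?(ltnW lj0).
  rewrite /S [leRHS]big_nat_recr//= lerDl invfM mulr_ge0 ?invr_ge0 ?(ltW a0)//.
  by rewrite ltW.
have [k ek] : exists k, expR 1 <= S k.
  apply: contrapT => /forallNP H; move: sum_gt; apply/negP; rewrite -leNgt.
  apply: lime_le.
    by apply: is_cvg_nneseries => k j0k _; rewrite lee_fin term_ge0.
  apply: nearW => -[|k]; rewrite sumEFin lee_fin.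
    by rewrite big_geq// mulr_ge0 ?expR_ge0// ltW.
  rewrite [leLHS](_ : _ = a * S k).
    by rewrite ler_pM2l// ltW// ltNge; apply/negP/H.
  by rewrite mulr_sumr; apply: eq_bigr => j _; rewrite invfM mulrA mulfV ?mul1r// gt_eqF.
have exk : exists k, expR 1 <= S k by exists k.
case: (ex_minnP exk) => -[|k1] ek1 min_k.
  by move: ek1; rewrite /S big_geq// leNgt expR_gt0.
exists k1; split=> //.
- rewrite leqNgt; apply/negP => k1j0; move: ek1.
  by rewrite /S big_geq// leNgt expR_gt0.
- rewrite natrM EFinM; congr (_ * _)%E; apply/eqP; rewrite eq_le; apply/andP; split.
  + apply: ge_ereal_sup => _ [l Sl <-]; rewrite lee_fin ler_nat leqNgt; apply/negP => k1l.
    by move: Sl; rewrite /= ltNge (le_trans ek1)// S_homo.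
  + apply: ereal_sup_ubound; exists k1 => //=; rewrite ltNge; apply/negP => /min_k.
    by rewrite ltnn.
Qed.

End BangDegree.

(** * Vanishing of directional derivatives at a point of a thick set *)

Section Vanishing.
Context {R : realType}.

Lemma powR_small (Q e kappa : R) : 0 < Q -> 0 < e -> 0 < kappa ->
  exists2 r0, 0 < r0 & forall r, 0 < r <= r0 -> Q * r `^ kappa <= e.
Proof.
move=> Q0 e0 kappa0; exists ((e / Q) `^ kappa^-1); first by rewrite powR_gt0// divr_gt0.
move=> r /andP[r0 rr0]; rewrite mulrC -ler_pdivlMr//.
have -> : e / Q = ((e / Q) `^ kappa^-1) `^ kappa.
  by rewrite -powRrM mulVf ?gt_eqF// powRr1// divr_ge0// ltW.
by rewrite ge0_ler_powR ?nnegrE ?powR_ge0// ltW.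
Qed.

Lemma dir_deriv_vanish {n} (p j : nat) (g : 'rV[R]_n.+1 -> R) (U K : set 'rV[R]_n.+1)
    (x v : 'rV[R]_n.+1) (c theta s : R) :
  open U -> class_C (p%:R%:E) g U -> U x -> (j <= p)%N -> (0 < p)%N -> v != 0 ->
  0 < c -> 0 < theta -> theta * j%:R < s ->
  (forall r, 0 < r <= 1 -> ((c * r `^ theta)%:E <= leb (K `&` eball x r))%E) ->
  (forall rho, 0 < rho -> exists2 r, 0 < r < rho &
     forall y, K y -> eball x r y -> `|g y| <= r `^ s) ->
  dir_deriv g v j x = 0.
Proof.
move=> U_open gC Ux jp p0 v0 c0 theta0 s_gt thick_x small_g.
apply/eqP; rewrite -normr_le0; apply/ler_addgt0Pr => e e0; rewrite add0r.
have e20 : 0 < e / 2 by rewrite divr_gt0.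
(* A common bound for the first partial derivatives near [x]; the [+ 1] is the slack for
   continuity. *)
pose M := \sum_i (`|pderiv [:: i] g x| + 1).
have M0 : 0 < M.
  rewrite /M (bigD1 0)//=; apply: ltr_wpDr; last exact: ltr_wpDl.
  by rewrite sumr_ge0// => i _; rewrite addr_ge0.
have M_ge i : `|pderiv [:: i] g x| + 1 <= M.
  by rewrite /M (bigD1 i)//= lerDl sumr_ge0// => k _; rewrite addr_ge0.
have [rho rho0 rhoP] : exists2 rho, 0 < rho & forall y, `|y - x| <= rho ->
    [/\ U y, `|dir_deriv g v j y - dir_deriv g v j x| <= e / 2 &
        forall i, `|pderiv [:: i] g y| <= M].
  apply: (nbhs_closed_ball x (fun y => [/\ U y,
    `|dir_deriv g v j y - dir_deriv g v j x| <= e / 2 & forall i, `|pderiv [:: i] g y| <= M])).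
  have FF : Filter (nbhs x) by typeclasses eauto.
  have nU := open_nbhs_nbhs (conj U_open Ux).
  have /cvgrPdist_le/(_ _ e20) nF := dir_deriv_continuous _ _ _ gC v _ _ jp Ux.
  have nM : nbhs x [set y | forall i, `|pderiv [:: i] g y| <= M].
    apply: (@filter_forall _ _ (fun i y => `|pderiv [:: i] g y| <= M) _ FF) => i.
    have := @pderiv_continuous _ _ _ _ _ gC [:: i] x p0 Ux.
    move=> /cvgrPdist_le/(_ _ ltr01); apply: filterS => y H.
    apply: le_trans (M_ge i); rewrite distrC in H.
    have := ler_normD (pderiv [:: i] g y - pderiv [:: i] g x) (pderiv [:: i] g x).
    rewrite subrK => /le_trans; apply; rewrite addrC lerD2l//.
  by apply: filterS3 nU nF nM => y H1; rewrite distrC.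
have k0 : (0 < 2 ^ j)%N by rewrite expn_gt0.
have [C C0 CP] := points_near_line v (2 ^ j) v0 k0.
(* With gaps [c * r^theta / C] and values at most [2 * r^s], the mean value theorem used [j] times
   yields [Q * r^(s - theta * j)]. *)
pose Q := (2 * C / c) ^+ j * 2.
have Q0 : 0 < Q by rewrite mulr_gt0// exprn_gt0// divr_gt0// mulr_gt0.
have kappa0 : 0 < s - theta * j%:R by rewrite subr_gt0.
have [r0 r00 r0P] := powR_small Q (e / 2) _ Q0 e20 kappa0.
have [r /andP[r_gt0]] : exists2 r, 0 < r < Num.min (Num.min 1 r0) (rho / 4) &
     forall y, K y -> eball x r y -> `|g y| <= r `^ s.
  by apply: small_g; rewrite !lt_min ltr01 r00 divr_gt0.
rewrite !lt_min => /andP[/andP[r1 rr0] rrho] g_le.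
pose L := M * n.+1%:R.
have L0 : 0 < L by rewrite mulr_gt0// ltr0n.
have rs0 : 0 < r `^ s by rewrite powR_gt0.
(* The second bound makes the move from [z i] onto the line change [g] by at most [r^s]. *)
pose eta0 := Num.min r (r `^ s / L).
have eta00 : 0 < eta0 by rewrite lt_min r_gt0 divr_gt0.
pose E := K `&` eball x r.
have Ex y : E y -> `|y - x| <= r.
  by move=> [_ /ltW]; apply: le_trans; exact: norm_le_enorm.
pose m := c * r `^ theta.
have m0 : 0 < m by rewrite mulr_gt0// powR_gt0.
have mE : (m%:E <= leb E)%E by apply: thick_x; rewrite r_gt0 ltW.
have [z [t [zP tgap]]] := CP x E m eta0 m0 eta00
  (fun y Ey => le_trans (Ex y Ey) (ltW r1)) mE.
have [Ez0 _] := zP 0%N k0.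
have normv : 0 < `|v| by rewrite normr_gt0.
(* Two points within [r] of [x] and an error [eta0 <= r] give [3 * r]. With [r < rho / 4], the piece
   of line starting within [r] of [x] stays in the ball of radius [rho]. *)
pose b := 3 * r / `|v|.
have b_ge0 : 0 <= b by rewrite divr_ge0// mulr_ge0// ltW.
have in_ball tau : - b <= tau <= b -> `|z 0%N + tau *: v - x| <= rho.
  rewrite -ler_norml => tau_b; rewrite addrAC.
  apply: le_trans (ler_normD _ _) _; rewrite normrZ.
  have : `|tau| * `|v| <= 3 * r by rewrite -ler_pdivlMr.
  have := Ex _ Ez0; lra.
have tau_itv i : (i < 2 ^ j)%N -> - b <= t i - t 0%N <= b.
  move=> ik; have [Ei di] := zP i ik; rewrite -ler_norml ler_pdivlMr// -normrZ.
  have eta_r : eta0 <= r by rewrite ge_min lexx.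
  have -> : (t i - t 0%N) *: v = (z i - x) - (z 0%N - x) - (z i - z 0%N - (t i - t 0%N) *: v).
    by apply/rowP => l; rewrite !mxE; ring.
  apply: le_trans (ler_normB _ _) _; apply: le_trans (lerD (ler_normB _ _) di) _.
  have := Ex _ Ei; have := Ex _ Ez0; lra.
have g_tau i : (i < 2 ^ j)%N -> `|g (z 0%N + (t i - t 0%N) *: v)| <= 2 * r `^ s.
  move=> ik; have [Ei di] := zP i ik; have [Ki Bi] := Ei.
  have zi_ball : `|z i - x| <= rho by apply: le_trans (Ex _ Ei) _; lra.
  (* With zero slopes the gradient estimate is a Lipschitz bound with constant [M]. *)
  have := increment_gradient_le g x (fun=> 0) rho M _ _ _ _ (in_ball _ (tau_itv i ik)) zi_ball.
  set y := z 0%N + _.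
  have -> : \sum_(l < n.+1) 0 * (y 0 l - z i 0 l) = 0.
    by apply: big1 => l _; rewrite mul0r.
  rewrite subr0 => lip.
  have {}lip : `|g y - g (z i)| <= M * \sum_(l < n.+1) `|y 0 l - z i 0 l|.
    apply: lip => w l /rhoP[Uw _ Mw]; last by rewrite subr0; exact: Mw.
    exact: (pderiv_derivable _ _ _ gC [::] l w p0 Uw).
  have sum_le : \sum_(l < n.+1) `|y 0 l - z i 0 l| <= n.+1%:R * eta0.
    apply: le_trans (_ : \sum_(l < n.+1) eta0 <= _); last first.
      by rewrite sumr_const card_ord -[leLHS]mulr_natl.
    apply: ler_sum => l _; apply: le_trans di; apply: le_trans (coord_le_norm _ l).
    by rewrite distrC !mxE le_eqVlt; apply/orP; left; apply/eqP; congr `|_|; ring.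
  have M_eta : M * (n.+1%:R * eta0) <= r `^ s.
    by rewrite mulrA -/L mulrC -ler_pdivlMr// ge_min lexx orbT.
  have M_sum : M * \sum_(l < n.+1) `|y 0 l - z i 0 l| <= M * (n.+1%:R * eta0).
    by rewrite ler_wpM2l// ltW.
  have := ler_normD (g y - g (z i)) (g (z i)); rewrite subrK.
  have := g_le _ Ki Bi; lra.
have delta0 : 0 < m / C by rewrite divr_gt0.
have [xi xi_b] := small_derivative_of_gaps (fun i tau => dir_deriv g v i (z 0%N + tau *: v))
  (- b) b (m / C) j delta0
  (fun i tau ij tau_b => is_derive_line _ _ _ _ _ (is_derive_dir_deriv _ _ _ U_open gC _ _ _
    (leq_trans ij jp) (let: And3 h1 _ _ := rhoP _ (in_ball tau tau_b) in h1)))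
  (2 * r `^ s) (fun i => t i - t 0%N)
  (fun i ik => conj (tau_itv i ik)
    (eq_ind_r (fun w => `|w| <= 2 * r `^ s) (g_tau i ik) (dir_deriv0 _ _ _)))
  (fun i ik => eq_ind_r (fun w => w <= _) (lerD (tgap i ik) (lexx (- t 0%N))) (addrAC _ _ _)).
have -> : (2 / (m / C)) ^+ j * (2 * r `^ s) = Q * r `^ (s - theta * j%:R).
  rewrite powRB ?gt_eqF ?implybT// powRrM powR_mulrn ?powR_ge0//.
  have -> : 2 / (m / C) = 2 * C / c * (r `^ theta)^-1.
    by rewrite /m; field; rewrite !lt0r_neq0// powR_gt0.
  by rewrite exprMn exprVn /Q; ring.
have rr0' : 0 < r <= r0 by rewrite r_gt0 ltW.
move=> /le_trans/(_ (r0P r rr0')) F_xi.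
have [_ dF _] := rhoP _ (in_ball xi xi_b).
have := ler_normB (dir_deriv g v j (z 0%N + xi *: v))
  (dir_deriv g v j (z 0%N + xi *: v) - dir_deriv g v j x).
rewrite opprB addrC subrK; lra.
Qed.

End Vanishing.

(** For [r < 1] the logarithm of [r] is negative, so a quotient above [s] bounds the logarithm of
    the supremum from above by [s * ln r]. *)
Lemma ord_gt_small {R : realType} {n : nat} (K : set 'rV[R]_n) (f : 'rV[R]_n -> R) x (s : R) :
  (s%:E < ord_at K f x)%E ->
  forall rho, 0 < rho -> exists2 r, 0 < r < rho &
    forall y, K y -> eball x r y -> `|f y| <= r `^ s.
Proof.
move=> s_lt rho rho0.
pose rho' := Num.min rho 1.
have rho'0 : 0 < rho' by rewrite lt_min rho0 ltr01.
pose F r := (lne (supnorm f (eball x r `&` K)) * (ln r)^-1%:E)%E.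
have [_ [r /= /andP[r0 rrho'] <-] sF] :
    exists2 l, [set F r | r in [set r | 0 < r < rho']] l & (s%:E < l)%E.
  apply: ereal_sup_gt; apply: lt_le_trans s_lt _.
  apply: ereal_inf_lbound; exists [set r | 0 < r < rho'] => //.
  near=> r; apply/andP; split; first by near: r; exact: nbhs_right_gt.
  by near: r; exact: nbhs_right_lt.
move: rrho'; rewrite lt_min => /andP[rrho r1]; rewrite /F in sF.
exists r; first by rewrite r0.
move=> y Ky By.
have lnr : ln r < 0 by rewrite -ln1 ltr_ln ?posrE.
have : (`|f y|%:E <= supnorm f (eball x r `&` K))%E.
  by apply: ereal_sup_ubound; exists y.
(* A supremum [+oo] would make the quotient [-oo], and [-oo] is excluded by the point [y]. The case
   [f y = 0] is separated because the logarithm needs a positive supremum. *)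
case: (supnorm _ _) sF => [S|sF _|]; [|exfalso|by rewrite leeNy_eq].
- rewrite lee_fin => + fS; have [f0|f0] := leP `|f y| 0.
    by move=> _; apply: le_trans f0 (powR_ge0 _ _).
  have S0 := lt_le_trans f0 fS.
  rewrite lne_EFin// -EFinM lte_fin ltr_ndivlMr// => lnS.
  apply: le_trans fS _; rewrite -(lnK S0) /powR gt_eqF// ler_expR ltW//.
- by move: sF; rewrite /= lt0_mulye ?lte_fin ?invr_lt0.
Unshelve. all: by end_near. Qed.

(* The degree d of the admissible collection fixed for K is universally
   quantified, subject only to d = 1 when K is a convex body. *)
Theorem corollary8p5 (R : realType) (n : nat) (hn : (0 < n)%N)
    (L K : set 'rV[R]_n) (d : nat)
    (hL : convex_body L)
    (hK : admissible_set d K) (hd : convex_body K -> d = 1%N)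
    (hKL : K `<=` L)
    (cK thetaK : R) (hthick : thick cK thetaK K)
    (mu : nat -> R) (hmu : admissible_weight mu)
    (hmuj : forall j : nat, (1 <= j)%N -> j%:R <= mu j)
    (M0 b0 : R) (hb0 : 0 < b0) (hM0 : b0 < M0)
    (hadm : admissible_tuple mu M0 (aconst d K) b0)
    (f : 'rV[R]_n -> R)
    (hf : smooth mu (degN mu M0 (aconst d K) b0) M0 L f)
    (hfK : (b0%:E <= supnorm f K)%E) :
  forall x, K x ->
    (ord_at K f x <= thetaK%:E * degN mu M0 (aconst d K) b0)%E.
Proof.
move=> x Kx.
case: n hn L K hL hK hd hKL hthick hadm f hf hfK x Kx => // n _ L K hL hK _ hKL.
move=> hthick hadm f hf hfK x Kx.
have [theta0 c0 _ _ thickK] : [/\ 0 < thetaK, 0 < cK, True, True & forall x r, K x -> 0 < r <= 1 ->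
    ((cK * r `^ thetaK)%:E <= leb (K `&` eball x r))%E] by case: hthick.
have [_ K_compact _] := hK; have [_ L_convex _] := hL.
have mu_gt0 j : 0 < mu j.+1 by apply: lt_le_trans (hmuj j.+1 isT); rewrite ltr0n.
have [k [j0k degE expS]] := degN_nat mu M0 (aconst d K) b0 mu_gt0 hadm.
set a := aconst d K in hadm hf degE expS *.
have [A0 a0 _ _] := hadm.
rewrite degE in hf *.
have [U [g [U_open LU gf gC g_le]]] := hf.
have j0_gt0 := start_index_gt0 M0 b0 hb0 hM0.
have k_gt0 : (0 < k)%N := leq_trans j0_gt0 j0k.
have kp : (k.+1 <= 2 * k)%N by rewrite mul2n -addnn -addn1 leq_add2l.
rewrite leNgt; apply/negP => ord_gt.
have small : forall rho, 0 < rho -> exists2 r, 0 < r < rho &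
    forall y, K y -> eball x r y -> `|g y| <= r `^ (thetaK * (2 * k)%N%:R).
  move=> rho rho0; have [r rrho fr] := ord_gt_small K f x (thetaK * (2 * k)%N%:R) ord_gt rho rho0.
  by exists r => // y Ky By; rewrite gf; [exact: fr|exact: hKL].
have Ux : U x by apply/LU/hKL.
have vanish (v : 'rV[R]_n.+1) j : v != 0 -> (j <= k)%N -> dir_deriv g v j x = 0.
  move=> v0 jk.
  apply: (dir_deriv_vanish (2 * k) j g U K x v cK thetaK (thetaK * (2 * k)%N%:R)) => //.
  - by rewrite (leq_trans jk)// ltnW.
  - exact: leq_trans kp.
  - by rewrite ltr_pM2l// ltr_nat (leq_ltn_trans jk).
  - by move=> r r01; exact: thickK.
have [w Kw fw] : exists2 w, K w & b0 <= `|g w|.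
  have gc : {within K, continuous (fun y => `|g y|)}.
    apply: continuous_in_subspaceT => y; rewrite inE => Ky.
    apply: continuous_comp; last exact: norm_continuous.
    apply: (@pderiv_continuous _ _ _ _ _ gC [::]) => //.
    by apply/LU/hKL.
  have [w] := EVT_max_rV (ex_intro _ x Kx) K_compact gc.
  rewrite inE => Kw wmax; exists w => //.
  rewrite -lee_fin; apply: le_trans hfK _; apply: ge_ereal_sup => _ [y Ky <-].
  rewrite lee_fin -gf; last exact: hKL.
  exact: wmax (mem_set Ky).
(* Order [0] along an arbitrary nonzero direction. This value shows that [w] differs from [x], so
   that [w - x] is a direction to which [vanish] applies. *)
have gx0 : g x = 0.
  rewrite -(dir_deriv0 g (const_mx 1)) vanish//.
  by apply/eqP => /rowP/(_ 0); rewrite !mxE => /eqP; rewrite oner_eq0.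
have v0 : w - x != 0.
  apply: contraTneq fw => /subr0_eq ->; rewrite gx0 normr0 -ltNge//.
pose v := w - x.
have v_le i : `|v 0 i| <= a.
  apply: le_trans (coord_le_enorm _ _) _; apply: le_trans (diam_le_aconst d K).
  exact: enorm_le_diam.
have segment t : 0 <= t <= 1 -> L (x + t *: v).
  move=> /andP[t0 t1].
  have := L_convex w x (Itv01 t0 t1); rewrite !inE => /(_ (hKL _ Kw) (hKL _ Kx)).
  have -> : x + t *: v = t *: w + (1 - t) *: x by apply/rowP => i; rewrite !mxE; ring.
  exact.
have A_S j : a ^+ j.+1 * Mseq mu M0 j.+1 = a ^+ j * Mseq mu M0 j * (a * mu j.+1).
  by rewrite /Mseq big_nat_recr//= exprS; ring.
(* The level is [k + 1]: orders up to [k] vanish at [x], while order [k + 1] is only bounded. This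
   brings the term of index [k + 1] into the sum, with which it reaches e. *)
have bang_mu := @bang_sum_inv_lt R (fun j t => dir_deriv g v j (x + t *: v))
  (fun j => a ^+ j * Mseq mu M0 j)  (fun j => a * mu j) k.+1 (start_index M0 b0).
move: expS; rewrite leNgt => /negP; apply; apply: bang_mu => //.
- by rewrite j0_gt0 leqW.
- move=> j t jk t01; apply: is_derive_line.
  apply: (is_derive_dir_deriv _ _ _ U_open gC) (leq_trans jk kp) _.
  exact/LU/segment.
- by move=> j jk; rewrite scale0r addr0 vanish.
- move=> j t jk t01; have Lt := segment t t01.
  apply: le_trans (dir_deriv_le _ _ _ U_open gC _ a _ _ v_le (leq_trans jk kp) (LU _ Lt)) _.
  rewrite ler_wpM2l ?exprn_ge0 ?(ltW a0)// -lee_fin.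
  have jN : ((j%:R)%:E < (2 * k)%N%:R%:E + 1 :> \bar R)%E.
    by rewrite -EFinD lte_fin natr1 ltr_nat ltnS (leq_trans jk kp).
  by apply: le_trans (g_le j jN); apply: ereal_sup_ubound; exists (x + t *: v).
- by rewrite expr0 mul1r /Mseq big_geq// mulr1.
- by move=> j; rewrite mulr_gt0.
- by move=> j; rewrite ler_pM2l//; apply: hmu.2.
- rewrite expr0 mul1r /Mseq big_geq// mulr1 scale1r addrC subrK dir_deriv0.
  by apply: le_trans fw; exact: start_index_exp.
Qed.
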